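(* Let $d\ge 1$ be an integer and let $1\le p,q<\infty$. Let $\phi\in W_{0}(L^{1,1})$ have compact support and satisfy $\sum_{k\in\mathbb{Z}^{d+1}}|\widehat{\phi}(\xi+2\pi k)|^{2}>0$ for every $\xi\in\mathbb{R}^{d+1}$. Let $P$ be a bounded projection from $L^{p,q}$ onto $V_{p,q}(\phi)$. Then there is a density $\gamma>0$, depending on $p$, $q$ and $P$, such that any $f\in V_{p,q}(\phi)$ can be reconstructed from its samples $\{f(x_j,y_k):(x_j,y_k)\in X\}$ on any strongly-separated $\gamma$-dense set $X=\{(x_j,y_k):j,k\in\mathbb{J}\}$ by the iterative algorithm $$f_{1}=PQ_{X}f,\qquad f_{n+1}=PQ_{X}(f-f_{n})+f_{n}\quad(n\ge 1),$$ where $Q_X$ is the quasi-interpolation operator built from a bounded uniform partition of unity associated to $X$ with supports in the balls $B_\gamma(x_j,y_k)$. That is, the iterates $f_n$ converge to $f$ in the $L^{p,q}$ norm and uniformly. Furthermore, the convergence is geometric: $$\|f-f_n\|_{L^{p,q}}\le M\alpha^{n}\quad\text{for all } n\ge 1,$$ for some $\alpha=\alpha(\gamma)<1$ and some $M<\infty$.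
   Context: Functions are complex-valued on $\mathbb{R}\times\mathbb{R}^{d}=\mathbb{R}^{d+1}$. $L^{p,q}=L^{p,q}(\mathbb{R}^{d+1})$ is the space of measurable $f=f(x,y)$ on $\mathbb{R}\times\mathbb{R}^d$ with $\|f\|_{L^{p,q}}=\left[\int_{\mathbb{R}}\left(\int_{\mathbb{R}^d}|f(x,y)|^{q}dy\right)^{p/q}dx\right]^{1/p}<\infty$. $\ell^{p,q}=\ell^{p,q}(\mathbb{Z}^{d+1})$ is the space of sequences $c=\{c(k_1,k_2)\}_{k_1\in\mathbb{Z},k_2\in\mathbb{Z}^d}$ with $\|c\|_{\ell^{p,q}}^p=\sum_{k_1\in\mathbb{Z}}\left(\sum_{k_2\in\mathbb{Z}^d}|c(k_1,k_2)|^q\right)^{p/q}<\infty$. $W(L^{1,1})$ is the space of measurable $f$ with $\|f\|_{W(L^{1,1})}=\sum_{n\in\mathbb{Z}}\sup_{x\in[0,1]}\sum_{l\in\mathbb{Z}^d}\sup_{y\in[0,1]^d}|f(x+n,y+l)|<\infty$, and $W_0(L^{1,1})$ is the space of continuous functions in $W(L^{1,1})$. $V_{p,q}(\phi)=\left\{\sum_{k_1\in\mathbb{Z}}\sum_{k_2\in\mathbb{Z}^d}c(k_1,k_2)\phi(\cdot-k_1,\cdot-k_2): c\in\ell^{p,q}\right\}$, a subspace of $L^{p,q}$; for $\phi$ continuous with compact support its elements are continuous functions, and sampling is applied to these continuous functions. The Fourier transform is $\widehat{\phi}(\xi)=\int_{\mathbb{R}^{d+1}}\phi(x)e^{-i x\cdot\xi}dx$.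 A bounded projection from $L^{p,q}$ onto $V_{p,q}(\phi)$ is a bounded linear operator $P$ on $L^{p,q}$ with $P^2=P$ and range $V_{p,q}(\phi)$. Sampling sets have the form $X=\{(x_j,y_k):j,k\in\mathbb{J}\}$ with $\mathbb{J}$ a countable index set, $x_j\in\mathbb{R}$, $y_k\in\mathbb{R}^d$. $B_\gamma(x_j,y_k)$ denotes the open ball in $\mathbb{R}^{d+1}$ with center $(x_j,y_k)$ and radius $\gamma$. $X$ is strongly-separated if $\inf_{(j,k)\neq(j',k')}|(x_j,y_k)-(x_{j'},y_{k'})|>0$. $X$ is $\gamma_0$-dense in $\mathbb{R}^{d+1}$ if $\mathbb{R}^{d+1}=\bigcup_{j,k}B_{\gamma}(x_j,y_k)$ for every $\gamma>\gamma_0$. A bounded uniform partition of unity associated to a strongly-separated set $X$ (with radius $\gamma$) is a family of measurable functions $\{\beta_{j,k}\}_{j,k\in\mathbb{J}}$ with $0\le\beta_{j,k}\le1$, $\operatorname{supp}\beta_{j,k}\subset B_\gamma(x_j,y_k)$ for all $j,k$, and $\sum_{j\in\mathbb{J}}\sum_{k\in\mathbb{J}}\beta_{j,k}=1$. The associated quasi-interpolant of a continuous function $f$ is $Q_Xf=\sum_{j\in\mathbb{J}}\sum_{k\in\mathbb{J}}f(x_j,y_k)\beta_{j,k}$. *)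

(* Defs.v *)
From HB Require Import structures.
From mathcomp Require Import all_boot all_order all_algebra.
From mathcomp Require Import all_classical all_reals all_analysis.
From mathcomp Require Import complex.
From mathcomp Require summability.

Set Implicit Arguments.
Unset Strict Implicit.
Unset Printing Implicit Defensive.

Import Order.TTheory GRing.Theory Num.Theory.
Import numFieldNormedType.Exports.
Local Open Scope classical_set_scope.
Local Open Scope ring_scope.

(* A point of R^{d+1} = R x R^d is a pair z : R * 'rV[R]_d.  'rV[R]_n carries
   the Borel sigma-algebra, generated by the coordinates as for n.-tuple.      *)

Section measurable_rV.
Context (R : realType) (n : nat).

Let coord : 'I_n -> 'rV[R]_n -> R := fun i v => v ord0 i.

HB.instance Definition _ :=
  @isMeasurable.Build (measure_tuple_display default_measure_display) 'rV[R]_n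
    (g_sigma_preimage coord) (@sigma_algebra0 _ _ _) (@sigma_algebraC _ _)
    (@sigma_algebra_bigcup _ _ _).

Lemma measurable_coord (i : 'I_n) :
  measurable_fun [set: 'rV[R]_n] (fun v : 'rV[R]_n => v ord0 i).
Proof.
move=> _ Y mY; rewrite setTI; apply: sub_sigma_algebra => /=.
rewrite -bigcup_seq/=; exists i => /=; first by rewrite mem_index_enum.
by exists Y => //; rewrite setTI.
Qed.

Lemma measurable_fun_rV d (T : measurableType d) (f : T -> 'rV[R]_n) :
  (forall i, measurable_fun [set: T] (fun x => f x ord0 i)) ->
  measurable_fun [set: T] f.
Proof.
move=> mf _ A; rewrite setTI; move: A.
suff : g_sigma_preimage coord `<=` [set A | measurable (f @^-1` A)] by [].
apply: smallest_sub.
  split; first by rewrite /= preimage_set0.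
    move=> A /= mA; rewrite setTD; exact: measurableC mA.
  by move=> F mF /=; rewrite preimage_bigcup; apply: bigcup_measurable => k _; exact: mF.
move=> A; rewrite -bigcup_seq/= => -[i _ [B mB <-]].
by rewrite setTI /= -[X in measurable X]setTI; exact: mf.
Qed.

End measurable_rV.

Definition rV_cons {R : realType} {n : nat}
    (p : measurableTypeR R * 'rV[R]_n) : 'rV[R]_n.+1 :=
  row_mx p.1%:M p.2.

Definition rV_uncons {R : realType} {n : nat} (v : 'rV[R]_n.+1) :
    measurableTypeR R * 'rV[R]_n :=
  (v ord0 ord0, \row_i v ord0 (lift ord0 i)).

Lemma rV_consK (R : realType) n : cancel (@rV_cons R n) rV_uncons.
Proof.
move=> [x v]; congr pair => /=.
  rewrite /rV_cons mxE; case: splitP => j //= _; by rewrite mxE !ord1 eqxx mulr1n.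
apply/rowP => i; rewrite /rV_cons !mxE; case: splitP => [j|j [ij]].
  by rewrite ord1.
by congr (v _ _); apply: val_inj.
Qed.

Lemma rV_unconsK (R : realType) n : cancel (@rV_uncons R n) rV_cons.
Proof.
move=> v; apply/rowP => i; rewrite /rV_cons mxE.
case: splitP => j /= ij; rewrite !mxE.
  by rewrite !ord1 eqxx mulr1n; congr (v _ _); apply: val_inj; rewrite /= ij ord1.
by congr (v _ _); apply: val_inj.
Qed.

Lemma measurable_rV_cons (R : realType) n :
  measurable_fun [set: measurableTypeR R * 'rV[R]_n] (@rV_cons R n).
Proof.
apply: measurable_fun_rV => i; rewrite /rV_cons.
under eq_fun do rewrite mxE.
case: (@fintype.split 1 n i) => j.
  under eq_fun do rewrite mxE !ord1 eqxx mulr1n. exact: measurable_fst.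
apply: (@measurableT_comp _ _ _ _ _ _ (fun v : 'rV[R]_n => v ord0 j)) => //.
exact: measurable_coord.
Qed.

Lemma measurable_rV_uncons (R : realType) n :
  measurable_fun [set: 'rV[R]_n.+1] (@rV_uncons R n).
Proof.
apply/measurable_fun_pairP; split => /=; first exact: measurable_coord.
apply: measurable_fun_rV => i /=; rewrite /comp /=.
by under eq_fun do rewrite mxE; exact: measurable_coord.
Qed.

Section lebesgue_rV_cons.
Context (R : realType) (n : nat).
Variable mu : {sigma_finite_measure set 'rV[R]_n -> \bar R}.

Definition lebesgue_rV_cons : set 'rV[R]_n.+1 -> \bar R :=
  pushforward (@lebesgue_measure R \x mu)%E rV_cons.


Let lebesgue_rV_cons0 : lebesgue_rV_cons set0 = 0%E.
Proof. by rewrite /lebesgue_rV_cons /pushforward preimage_set0 measure0. Qed.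

Let lebesgue_rV_cons_ge0 A : (0 <= lebesgue_rV_cons A)%E.
Proof. by apply: integral_ge0. Qed.

Let lebesgue_rV_cons_sigma_additive : semi_sigma_additive lebesgue_rV_cons.
Proof.
have mc (A : set 'rV[R]_n.+1) : measurable A -> measurable (@rV_cons R n @^-1` A).
  by move=> mA; rewrite -[X in measurable X]setTI; exact: measurable_rV_cons.
move=> F mF tF mUF; rewrite /lebesgue_rV_cons /pushforward preimage_bigcup.
apply: measure_semi_sigma_additive.
- by move=> k; apply: mc; exact: mF.
- apply/trivIsetP => i j _ _ ij; rewrite -preimage_setI.
  by move/trivIsetP : tF => /(_ _ _ _ _ ij) ->//; rewrite preimage_set0.
- by rewrite -preimage_bigcup; exact: mc.
Qed.

HB.instance Definition _ := isMeasure.Build _ _ _ lebesgue_rV_cons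
  lebesgue_rV_cons0 lebesgue_rV_cons_ge0 lebesgue_rV_cons_sigma_additive.

Let lebesgue_rV_cons_sigma_finite : sigma_finite setT lebesgue_rV_cons.
Proof.
have /sigma_finiteP[F [FT ndF Foo]] := sigma_finiteT (@lebesgue_measure R).
have /sigma_finiteP[G [GT ndG Goo]] := sigma_finiteT mu.
exists (fun k => @rV_uncons R n @^-1` (F k `*` G k)).
  apply/esym/seteqP; split=> // v _.
  have [k _ Fk] : (\bigcup_k F k) (rV_uncons v).1 by rewrite -FT.
  have [l _ Gl] : (\bigcup_k G k) (rV_uncons v).2 by rewrite -GT.
  exists (maxn k l) => //; split.
    by move: Fk; exact/subsetPset/ndF/leq_maxl.
  by move: Gl; exact/subsetPset/ndG/leq_maxr.
move=> k; have [mFk Fkoo] := Foo k; have [mGk Gkoo] := Goo k; split.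
  rewrite -[X in measurable X]setTI; apply: measurable_rV_uncons => //.
  exact: measurableX.
rewrite /lebesgue_rV_cons /pushforward -comp_preimage.
suff -> : @rV_uncons R n \o rV_cons = id.
  by rewrite product_measure1E// lte_mul_pinfty// ge0_fin_numE.
by apply/funext => p /=; rewrite rV_consK.
Qed.

HB.instance Definition _ := Measure_isSigmaFinite.Build _ _ _ lebesgue_rV_cons
  lebesgue_rV_cons_sigma_finite.

End lebesgue_rV_cons.

(* Lebesgue measure on R^n; the recursion identifies R^{n+1} with R x R^n. *)
Fixpoint lebesgue_rV (R : realType) (n : nat) :
    {sigma_finite_measure set 'rV[R]_n -> \bar R} :=
  match n with
  | 0 => dirac (0 : 'rV[R]_0)
  | n'.+1 => lebesgue_rV_cons (lebesgue_rV R n')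
  end.

Definition lebesgue_prod (R : realType) (d : nat) :
    {measure set (measurableTypeR R * 'rV[R]_d) -> \bar R} :=
  (@lebesgue_measure R \x lebesgue_rV R d)%E.

Section definitions.
Context {R : realType} {d : nat}.
Local Notation pt := (R * 'rV[R]_d)%type.
Local Notation normc := Normc.normc.

Implicit Types (f g phi : pt -> R[i]) (p q gamma : R).

(* Unconditional sum: the limit of the finite partial sums along the finite
   subsets of I ordered by inclusion.                                          *)
Definition csum (I : choiceType) (F : I -> R[i]) : R[i] :=
  summability.sum (F : I -> R[i]^o).

Definition supp (T : topologicalType) (V : zmodType) (f : T -> V) : set T :=
  closure [set z | f z <> 0].

Definition cmeasurable f : Prop :=
  measurable_fun [set: measurableTypeR R * 'rV[R]_d]
    (fun z => complex.Re (f z)) /\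
  measurable_fun [set: measurableTypeR R * 'rV[R]_d]
    (fun z => complex.Im (f z)).

Definition cae_eq f g : Prop := {ae lebesgue_prod R d, forall z, f z = g z}.

Definition Lpq_norm p q f : \bar R :=
  ((\int[@lebesgue_measure R]_x
      (\int[lebesgue_rV R d]_y (normc (f (x, y)) `^ q)%:E) `^ (p / q))
   `^ p^-1)%E.

Definition Lpq p q : set (pt -> R[i]) :=
  [set f | cmeasurable f /\ (Lpq_norm p q f < +oo)%E].

Definition lpq_norm p q (c : int -> 'rV[int]_d -> R[i]) : \bar R :=
  ((\esum_(k1 in [set: int])
      (\esum_(k2 in [set: 'rV[int]_d]) (normc (c k1 k2) `^ q)%:E) `^ (p / q))
   `^ p^-1)%E.

Definition unit_cube : set 'rV[R]_d := [set y | forall i, 0 <= y ord0 i <= 1].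

Definition W11_norm f : \bar R :=
  (\esum_(n in [set: int])
     ereal_sup
       [set \esum_(l in [set: 'rV[int]_d])
              ereal_sup
                [set (normc (f ((x + n%:~R)%R, (y + map_mx intr l)%R)))%:E
                | y in unit_cube]
       | x in `[0%R, 1%R]])%E.

Definition W11 : set (pt -> R[i]) :=
  [set f | cmeasurable f /\ (W11_norm f < +oo)%E].

Definition W11_0 : set (pt -> R[i]) :=
  [set f | W11 f /\ continuous (f : pt -> R[i]^o)].

(* Elements of V are honest functions, not classes modulo a.e. equality. *)
Definition Vpq p q phi : set (pt -> R[i]) :=
  [set f | exists2 c : int -> 'rV[int]_d -> R[i], (lpq_norm p q c < +oo)%E &
    forall z, f z = csum (fun k1 : int => csum (fun k2 : 'rV[int]_d =>
      c k1 k2 * phi (z.1 - k1%:~R, z.2 - map_mx intr k2)))].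

Definition dotp (z w : pt) : R :=
  z.1 * w.1 + \sum_(i < d) z.2 ord0 i * w.2 ord0 i.

Definition expi (t : R) : R[i] := (cos t +i* sin t)%C.

Definition cintegral f : R[i] :=
  ((\int[lebesgue_prod R d]_z complex.Re (f z)) +i*
   (\int[lebesgue_prod R d]_z complex.Im (f z)))%C.

Definition fourier f (xi : pt) : R[i] :=
  cintegral (fun z => f z * expi (- dotp z xi)).

Definition shift2pi (xi : pt) (k : int * 'rV[int]_d) : pt :=
  (xi.1 + 2 * pi * k.1%:~R, xi.2 + (2 * pi) *: map_mx intr k.2).

(* L^{p,q} is represented by functions, so every identity between elements of
   L^{p,q} is an a.e. equality; boundedness and linearity force P to send a.e.
   equal functions to a.e. equal functions.                                    *)
Definition bounded_projection p q phi (P : (pt -> R[i]) -> pt -> R[i]) : Prop :=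
  [/\ forall f, Lpq p q f -> Lpq p q (P f),
      forall (a : R[i]) f g, Lpq p q f -> Lpq p q g ->
        cae_eq (P (fun z => a * f z + g z)) (fun z => a * P f z + P g z),
      exists C : R, forall f, Lpq p q f ->
        (Lpq_norm p q (P f) <= C%:E * Lpq_norm p q f)%E,
      forall f, Lpq p q f -> cae_eq (P (P f)) (P f) &
      (forall f, Lpq p q f -> exists2 g, Vpq p q phi g & cae_eq (P f) g) /\
      (forall g, Vpq p q phi g -> exists2 f, Lpq p q f & cae_eq (P f) g)].

(* The norm of the library on R * 'rV[R]_d is the sup norm. *)
Definition enorm (z : pt) : R := Num.sqrt (dotp z z).

Definition eball (z : pt) (r : R) : set pt := [set w | enorm (w - z) < r].

Section sampling.
Context {J : countType} (x : J -> R) (y : J -> 'rV[R]_d).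

Definition strongly_separated : Prop :=
  (0 < ereal_inf [set (enorm ((x jk.1.1, y jk.1.2) - (x jk.2.1, y jk.2.2)))%:E
                 | jk in [set jk : (J * J) * (J * J) | jk.1 <> jk.2]])%E.

Definition dense_sampling (gamma0 : R) : Prop :=
  forall gamma, gamma0 < gamma ->
    [set: pt] = \bigcup_(jk in [set: J * J]) eball (x jk.1, y jk.2) gamma.

Definition bupu gamma (beta : J -> J -> pt -> R) : Prop :=
  [/\ forall j k,
        measurable_fun [set: measurableTypeR R * 'rV[R]_d] (beta j k),
      forall j k z, 0 <= beta j k z <= 1,
      forall j k, supp (beta j k) `<=` eball (x j, y k) gamma &
      forall z, (\esum_(j in [set: J]) \esum_(k in [set: J])
                   (beta j k z)%:E = 1)%E].

Definition quasi_interpolant (beta : J -> J -> pt -> R) f : pt -> R[i] :=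
  fun z => csum (fun j : J => csum (fun k : J =>
    f (x j, y k) * (beta j k z)%:C%C)).

End sampling.

(* The index starts at 1 (u 0 is unconstrained).  P Q f is a class modulo a.e.
   equality; u n is its representative in V, the one which is sampled.         *)
Definition iterates p q phi (P Q : (pt -> R[i]) -> pt -> R[i]) f
    (u : nat -> pt -> R[i]) : Prop :=
  [/\ forall n, (1 <= n)%N -> Vpq p q phi (u n),
      cae_eq (u 1%N) (P (Q f)) &
      forall n, (1 <= n)%N ->
        cae_eq (u n.+1) (fun z => P (Q (fun w => f w - u n w)) z + u n z)].

End definitions.

(* Main.v *)
(** The shift-invariant space V is the range of a bounded projection, hence
complete for the L^{p,q} norm, and the synthesis map c |-> sum_k c(k) phi(. - k)
is bounded from l^{p,q} onto V.  By the open mapping theorem every g in V has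
coefficients c with |c| <= C |g|.  As phi is uniformly continuous with compact
support, |g(z) - g(w)| <= eps * (sum of |c(k)| over the k near z) as soon as
|z - w| < gamma, so that |g - Q g| <= eps' |g|.  The errors h_n = f - f_n
satisfy h_{n+1} = P (h_n - Q h_n), and choosing eps' small makes the iteration
contract by 1/2.  The bound |c| <= C |g| also turns L^{p,q} convergence in V into
uniform convergence. *)

(* Elements of L^{p,q} are functions rather than classes, so the norm is only a seminorm, and the
   triangle inequality is used with the crude constant 8. The open mapping argument is therefore
   written for relations meaning size at most r. Repeated sums would accumulate powers of 8; the
   decay ratio 1/16 prevents this: if the tail after the first term is at most 16 (r / 16) = r, the
   whole is at most 8 (r + r) = 16 r. Open mapping only gives coefficients whose synthesis lies at
   distance 0 from g. Continuity of the synthesized functions turns this into equality everywhere,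
   which sampling at single points requires. A sequence c is treated as the step function equal to
   c(k) on the unit cell k, so that l^{p,q} bounds are L^{p,q} bounds. The estimates are local: on a
   unit cell a synthesized function involves a fixed finite number of coefficients, and the sum of
   their moduli, a finite sum of shifts of |c|, controls both its size and its oscillation. *)
Require Import Defs.
From HB Require Import structures.
From mathcomp Require Import all_boot all_order all_algebra.
From mathcomp Require Import all_classical all_reals all_analysis.
From mathcomp Require Import complex measurable_realfun.
From mathcomp Require unstable summability finmap.
From mathcomp Require Import ring lra.

Import Order.TTheory GRing.Theory Num.Theory.
Import numFieldNormedType.Exports.
Local Open Scope classical_set_scope.
Local Open Scope ring_scope.

Set Implicit Arguments.
Unset Strict Implicit.
Unset Printing Implicit Defensive.

(** * Open mapping theorem *)

(* [bE e r] stands for |e| <= r, where |.| is a seminorm up to the constant K in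
   the triangle inequality, and similarly for [bF]; [sE] and [sF] scale by a real. *)
Section open_mapping.
Context (R : realType) (E F : zmodType).
Variables (bE : E -> R -> Prop) (bF : F -> R -> Prop).
Variables (sE : R -> E -> E) (sF : R -> F -> F) (T : E -> F) (K C rho : R).
Hypotheses (K0 : 0 < K) (C0 : 0 < C) (rho01 : 0 < rho < 1).
Hypothesis bE0 : bE 0 0.
Hypothesis bF0 : bF 0 0.
Hypothesis bE_le : forall e r s, r <= s -> bE e r -> bE e s.
Hypothesis bF_le : forall v r s, r <= s -> bF v r -> bF v s.
Hypothesis bEB : forall e e' r s, bE e r -> bE e' s -> bE (e - e') (K * (r + s)).
Hypothesis bFB : forall v v' r s, bF v r -> bF v' s -> bF (v - v') (K * (r + s)).
Hypothesis bFN : forall v r, bF v r -> bF (- v) r.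
Hypothesis bEZ : forall (a : R) e r, 0 < a -> bE e r -> bE (sE a e) (a * r).
Hypothesis bFZ : forall (a : R) v r, 0 < a -> bF v r -> bF (sF a v) (a * r).
Hypothesis TB : forall e e', T (e - e') = T e - T e'.
Hypothesis TZ : forall a e, T (sE a e) = sF a (T e).
Hypothesis sFB : forall a u v, sF a (u - v) = sF a u - sF a v.
Hypothesis sFK : forall (a : R) v, 0 < a -> sF a (sF a^-1 v) = v.
Let fin e := exists r, bE e r.
Hypothesis bT : exists2 B : R, 0 < B & forall e r, bE e r -> bF (T e) (B * r).
Hypothesis completeE : forall (e : nat -> E) (r : R), 0 < r ->
  (forall k, bE (e k) (r * rho ^+ k)) ->
  exists s, forall n, bE (s - \sum_(k < n) e k) (C * (r * rho ^+ n)).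
Hypothesis completeF : forall (e : nat -> E) (r : nat -> R),
  (forall k, fin (e k)) -> (forall k, 0 < r k) ->
  (forall k, r k.+1 <= rho * r k) -> (forall k, bF (T (e k)) (r k)) ->
  exists2 s, fin s & forall n, bF (T s - T (\sum_(k < n) e k)) (C * r n).

Let finB e e' : fin e -> fin e' -> fin (e - e').
Proof. by move=> [r er] [s es]; exists (K * (r + s)); exact: bEB. Qed.

Let T0 : T 0 = 0. Proof. by rewrite -(subrr 0) TB subrr. Qed.

Let TD e e' : T (e + e') = T e + T e'.
Proof. by rewrite -{1}(opprK e') -(sub0r e') !TB T0 sub0r opprK. Qed.

(* Baire's argument in the range of T: were no image of a ball dense in a ball, a
   rapidly converging sequence avoiding all of them would have its limit outside
   the range. *)
Let somewhere_dense : exists (m : nat) r e0, [/\ 0 < r, fin e0 &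
  forall e, fin e -> bF (T e - T e0) r -> forall eps, 0 < eps ->
    exists2 e', bE e' m%:R & bF (T e - T e') eps].
Proof.
apply: contrapT => H.
have {}H (x : nat * (E * R)) : exists y : E * R, fin x.2.1 -> 0 < x.2.2 ->
    [/\ fin y.1, 0 < y.2, y.2 <= rho * x.2.2, bF (T y.1 - T x.2.1) x.2.2 &
        forall e', bE e' x.1%:R -> ~ bF (T y.1 - T e') (C * y.2)].
  case: x => m [e0 r] /=.
  have [[fe0 r0]|nh] := pselect (fin e0 /\ 0 < r); last first.
    by exists (e0, r) => ? ?; exfalso; apply: nh.
  have : exists2 e, fin e & bF (T e - T e0) r /\
      exists2 eps, 0 < eps & forall e', bE e' m%:R -> ~ bF (T e - T e') eps.
    apply: contrapT => nH; apply: H; exists m, r, e0; split => // e fe be eps eps0.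
    apply: contrapT => ne; apply: nH; exists e => //; split => //.
    by exists eps => // e' be' bTe; apply: ne; exists e'.
  move=> [e fe [be [eps eps0 He]]].
  (* [rho * r] gives the decay that [completeF] asks for; [eps / C] keeps everything within the tail
     bound [C * y.2] of [T e] away from the images of the ball of radius [m]. *)
  exists (e, Num.min (rho * r) (eps / C)) => _ _; split => //=.
  - by rewrite lt_min mulr_gt0 ?divr_gt0//; case/andP: rho01.
  - by rewrite ge_min lexx.
  - move=> e' be' bTe; apply: (He e' be'); apply: bF_le bTe.
    by rewrite mulrC -ler_pdivlMr// ge_min lexx orbT.
have [f Hf] := choice H.
pose st := fix st n := if n is m.+1 then f (m, st m) else (0, 1) : E * R.
have st_ok n : fin (st n).1 /\ 0 < (st n).2.
  elim: n => [|n [fn rn]] /=; first by split => //; exists 0.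
  by have [] := Hf (n, st n) fn rn.
pose d n := (st n.+1).1 - (st n).1.
have dsum n : \sum_(k < n) d k = (st n).1.
  elim: n => [|n IH]; first by rewrite big_ord0.
  by rewrite big_ord_recr /= IH /d addrC subrK.
have [||||s [M sM] Hs] := @completeF d (fun n => (st n).2).
- by move=> k; apply: finB; apply: (st_ok _).1.
- by move=> k; exact: (st_ok k).2.
- by move=> k; have [] := Hf (k, st k) (st_ok k).1 (st_ok k).2.
- by move=> k; rewrite /d TB; have [] := Hf (k, st k) (st_ok k).1 (st_ok k).2.
(* The limit [s] has size at most [M], hence at most [m]. Stage [m] chose the centre number [m.+1]
   far from the images of all such elements, while the tail bound at [m.+1] puts [T s] close to that
   centre. *)
pose m := Num.bound M.
have [_ _ _ _ /(_ s)] := Hf (m, st m) (st_ok m).1 (st_ok m).2.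
apply.
  apply: bE_le sM; exact/ltW/unstable.ltr_bound.
have := Hs m.+1; rewrite dsum => /bFN; rewrite opprB; exact.
Qed.

(** The dense ball is moved to the origin by subtraction: [e] is scaled by [a = r / t], approximants
    [e1] of [e0 + a e] and [e2] of [e0] are taken with size at most [m], and [e1 - e2] is scaled
    back. The summand 1 in [M] keeps it positive when [m = 0]. *)
Let almost_open : exists2 M, 0 < M & forall e t, fin e -> 0 < t -> bF (T e) t ->
  forall eps, 0 < eps -> exists2 e', bE e' (M * t) & bF (T e - T e') eps.
Proof.
have [m [r [e0 [r0 fe0 H]]]] := somewhere_dense.
pose M := K * (m%:R + m%:R) / r + 1.
have M0 : 0 <= K * (m%:R + m%:R) / r.
  by rewrite divr_ge0 ?mulr_ge0 ?addr_ge0 ?ler0n ?ltW.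
exists M; first by rewrite /M ltr_wpDl.
move=> e t fe t0 be eps eps0.
pose a := r / t; have a0 : 0 < a by rewrite divr_gt0.
have finZ e' : fin e' -> fin (sE a e').
  by move=> [s es]; exists (a * s); exact: bEZ.
have finD e1 e2 : fin e1 -> fin e2 -> fin (e1 + e2).
  move=> f1 f2; rewrite -(opprK e2) -(sub0r e2); apply: finB => //.
  by apply: finB => //; exists 0.
(* Two errors [eps'] combine to [K * (eps' + eps')], which is exactly [eps] after scaling by
   [a^-1]. *)
pose eps' := a * eps / (2 * K).
have eps'0 : 0 < eps' by rewrite /eps' divr_gt0 // mulr_gt0.
have fe1 : fin (e0 + sE a e) by apply: finD => //; exact: finZ.
have be1 : bF (T (e0 + sE a e) - T e0) r.
  rewrite -TB [e0 + _]addrC addrK TZ; apply: bF_le (bFZ a0 be).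
  by rewrite /a divfK// gt_eqF.
have be2 : bF (T e0 - T e0) r.
  by rewrite subrr; apply: bF_le bF0; exact: ltW.
have [e1 b1 c1] := H _ fe1 be1 _ eps'0.
have [e2 b2 c2] := H _ fe0 be2 _ eps'0.
exists (sE a^-1 (e1 - e2)).
  apply: bE_le (bEZ _ (bEB b1 b2)); last by rewrite invr_gt0.
  have -> : a^-1 * (K * (m%:R + m%:R)) = K * (m%:R + m%:R) / r * t.
    by rewrite /a; field; rewrite !gt_eqF.
  by rewrite ler_pM2r// /M lerDl.
have bb := bFB c1 c2.
have -> : T e - T (sE a^-1 (e1 - e2)) =
    sF a^-1 ((T (e0 + sE a e) - T e1) - (T e0 - T e2)).
  rewrite TZ TB TD TZ.
  have -> : T e0 + sF a (T e) - T e1 - (T e0 - T e2) = sF a (T e) - (T e1 - T e2).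
    rewrite !opprB [T e0 + _]addrC -!addrA; congr (_ + _).
    by rewrite addrCA [T e2 - T e0]addrC addNKr addrC.
  rewrite [RHS]sFB; congr (_ - _); have := @sFK a^-1 (T e); rewrite invrK invr_gt0 => -> //.
apply: bF_le (bFZ _ bb); last by rewrite invr_gt0.
rewrite /eps' le_eqVlt; apply/orP; left; apply/eqP; field.
by rewrite !gt_eqF.
Qed.

(** Successive approximation: each application of [almost_open] shrinks the remainder by [rho], and
    the corrections sum by [completeE]. As [bF] is a seminorm, the conclusion is distance zero
    rather than equality; [synth_eq0] closes that gap in the application. *)
Lemma open_mapping : exists2 B, 0 < B & forall e t, 0 < t -> fin e ->
  bF (T e) t -> exists2 e', bE e' (B * t) &
                            forall eps, 0 < eps -> bF (T e - T e') eps.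
Proof.
have [M M0 HM] := almost_open.
exists (C * M); first exact: mulr_gt0.
move=> w t t0 fw bw.
have [rho0 rho1] := andP rho01.
have rhon n : 0 < t * rho ^+ n by rewrite mulr_gt0// exprn_gt0.
have H (x : nat * E) : exists e, fin x.2 -> bF (T x.2) (t * rho ^+ x.1) ->
    bE e (M * (t * rho ^+ x.1)) /\ bF (T (x.2 - e)) (t * rho ^+ x.1.+1).
  case: x => n e /=.
  have [[fe be]|nh] := pselect (fin e /\ bF (T e) (t * rho ^+ n)); last first.
    by exists e => ? ?; exfalso; apply: nh.
  have [e' b1 b2] := HM e _ fe (rhon n) be _ (rhon n.+1).
  by exists e' => _ _; rewrite TB.
have [f Hf] := choice H.
pose st := fix st n := if n is m.+1 then st m - f (m, st m) else w.
have st_ok n : fin (st n) /\ bF (T (st n)) (t * rho ^+ n).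
  elim: n => [|n [fn bn]] /=; first by rewrite expr0 mulr1.
  have [b1 b2] := Hf (n, st n) fn bn; split => //.
  by apply: finB => //; exists (M * (t * rho ^+ n)).
pose e n := f (n, st n).
have esum n : \sum_(k < n) e k = w - st n.
  elim: n => [|n IH]; first by rewrite big_ord0 subrr.
  by rewrite big_ord_recr /= IH opprB addrA [RHS]addrAC.
have [k|s Hs] := @completeE e (M * t) (mulr_gt0 M0 t0).
  by rewrite -mulrA; have [] := Hf (k, st k) (st_ok k).1 (st_ok k).2.
exists s; first by have := Hs 0; rewrite big_ord0 subr0 expr0 mulr1 mulrA.
move=> eps eps0; have [B B0 HB] := bT.
(* [D * rho ^+ n] bounds [T w - T s], written as the image of the remainder [st n] minus the image
   of the tail of the correction series. *)
pose D := K * (1 + B * (C * M)) * t.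
have D0 : 0 < D by rewrite !mulr_gt0 // addr_gt0 ?mulr_gt0.
have [n Hn] : exists n, rho ^+ n < eps / D.
  have := @cvg_expr R rho; rewrite ger0_norm ?ltW// => /(_ rho1)/cvgrPdist_lt.
  move=> /(_ (eps / D)); rewrite divr_gt0// => /(_ isT) [n _ /(_ n (leqnn n))] /=.
  by rewrite sub0r normrN ger0_norm ?exprn_ge0 ?ltW// => ?; exists n.
have := bFB (st_ok n).2 (HB _ _ (Hs n)).
rewrite -TB opprB addrA [st n + _]addrC esum subrK TB; apply: bF_le.
  rewrite ltr_pdivlMr// in Hn; apply: le_trans (ltW Hn).
  by rewrite /D le_eqVlt; apply/orP; left; apply/eqP; ring.
Qed.
End open_mapping.

(** * Mixed-norm integrals *)

Section poweR_facts.
Context {R : realType}.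
Implicit Types (a b : \bar R) (r : R).
Local Open Scope ereal_scope.

Lemma ge0_le_poweR r a b : (0 <= r)%R -> 0 <= a -> a <= b -> a `^ r <= b `^ r.
Proof.
move=> r0 a0 ab; apply: gt0_ler_poweR => //; rewrite in_itv/= leey andbT//.
exact: le_trans ab.
Qed.

(** The sum is at most twice the larger term. This also covers [r < 1], which occurs for the outer
    exponent [p / q]. *)
Lemma poweR_add_le r a b : (0 <= r)%R -> 0 <= a -> 0 <= b ->
  (a + b) `^ r <= (2 `^ r)%:E * (a `^ r + b `^ r).
Proof.
move=> r0; wlog ab : a b / a <= b => [H a0 b0|a0 b0].
  case/orP: (le_total a b) => [|ba]; first by move=> /H; exact.
  by rewrite addeC [X in _ * X]addeC; exact: H.
apply: (@le_trans _ _ ((2%:E * b) `^ r)).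
  apply: ge0_le_poweR; rewrite ?adde_ge0//.
  by rewrite -[2%R]/(1 + 1)%R EFinD ge0_muleDl// mul1e leeD2r.
rewrite poweRM ?lee_fin// poweR_EFin lee_pmul ?poweR_ge0 ?lee_fin ?powR_ge0//.
by rewrite leeDr// poweR_ge0.
Qed.

(** Limits of monotone sequences are suprema, and the powers [r] and [r^-1] are both monotone and
    inverse to each other, so the power commutes with the supremum, infinite values included. *)
Lemma nd_poweR_cvg r (u : nat -> \bar R) (l : \bar R) : (0 < r)%R ->
  (forall n, 0 <= u n) -> nondecreasing_seq u -> u @ \oo --> l ->
  (fun n => u n `^ r) @ \oo --> l `^ r.
Proof.
move=> r0 u0 ndu ul.
have ls : l = ereal_sup (range u).
  by apply: (cvg_unique _ ul) => //; exact: ereal_nondecreasing_cvgn.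
have ule n : u n <= l by rewrite ls; apply: ereal_sup_ubound; exists n.
have l0 : 0 <= l := le_trans (u0 0%N) (ule 0%N).
have nd : nondecreasing_seq (fun n => u n `^ r).
  by move=> m n mn; apply: ge0_le_poweR => //; [exact: ltW|exact: ndu].
have cv := ereal_nondecreasing_cvgn nd.
pose s := ereal_sup (range (fun n => u n `^ r)).
have us n : u n `^ r <= s by apply: ereal_sup_ubound; exists n.
rewrite -/s in cv.
suff -> : l `^ r = s by [].
apply/le_anti/andP; split; last first.
  apply: ge_ereal_sup => _ [n _ <-]; apply: ge0_le_poweR => //; exact: ltW.
have un n : u n <= s `^ r^-1.
  rewrite -[u n]poweRe1// -(@mulfV _ r) ?gt_eqF// poweRrM.
  by apply: ge0_le_poweR; [rewrite invr_ge0 ltW|exact: poweR_ge0|exact: us].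
have s0 : 0 <= s := le_trans (poweR_ge0 (u 0%N) r) (us 0%N).
have : l <= s `^ r^-1 by rewrite ls; apply: ge_ereal_sup => _ [n _ <-].
move=> /(@ge0_le_poweR r); rewrite -poweRrM mulVf ?gt_eqF// poweRe1//; apply => //.
exact: ltW.
Qed.

End poweR_facts.

Section mixed_norm.
Context d1 d2 (X : measurableType d1) (Y : measurableType d2) (R : realType).
Variables (m1 : {sigma_finite_measure set X -> \bar R})
          (m2 : {sigma_finite_measure set Y -> \bar R}).
Variables (p q : R).
Hypotheses (p1 : 1 <= p) (q1 : 1 <= q).
Local Open Scope ereal_scope.

(** The p-th power of the mixed norm. Without the outer root, monotone convergence applies directly;
    [Lpq_norm_le] returns to the norm. *)
Definition mixint (G : X * Y -> \bar R) : \bar R :=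
  \int[m1]_x (\int[m2]_y (G (x, y) `^ q)) `^ (p / q).

Implicit Types G H : X * Y -> \bar R.

Let p0 : (0 < p)%R. Proof. exact: lt_le_trans p1. Qed.
Let q0 : (0 < q)%R. Proof. exact: lt_le_trans q1. Qed.
Let pq0 : (0 < p / q)%R. Proof. exact: divr_gt0. Qed.

Let mpow G (r : R) : measurable_fun setT G -> measurable_fun setT (fun z => G z `^ r).
Proof. by move=> mG; exact: (measurableT_comp (measurable_poweR r)). Qed.

Let mslice G x : measurable_fun setT G ->
  measurable_fun setT (fun y => G (x, y) `^ q).
Proof.
by move=> /(mpow q) mG; exact: (measurableT_comp mG (measurable_pair1 x)).
Qed.

Let minner G : measurable_fun setT G ->
  measurable_fun setT (fun x => (\int[m2]_y (G (x, y) `^ q)) `^ (p / q)).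
Proof.
move=> /(mpow q) mG; apply: (measurableT_comp (measurable_poweR _)).
apply: (@measurable_fun_fubini_tonelli_F _ _ _ _ _ m2 _ mG) => z.
exact: poweR_ge0.
Qed.

Let inner_ge0 G x : 0 <= \int[m2]_y (G (x, y) `^ q).
Proof. by apply: integral_ge0 => y _; exact: poweR_ge0. Qed.

Lemma mixint_ge0 G : 0 <= mixint G.
Proof. by apply: integral_ge0 => x _; exact: poweR_ge0. Qed.

Lemma le_mixint G H : measurable_fun setT G -> measurable_fun setT H ->
  (forall z, 0 <= G z) -> (forall z, G z <= H z) -> mixint G <= mixint H.
Proof.
move=> mG mH G0 GH; apply: ge0_le_integral => //=; try exact: minner.
  by move=> x _; exact: poweR_ge0.
move=> x _; apply: ge0_le_poweR => //; first exact: ltW.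
apply: ge0_le_integral => //=; try exact: mslice.
  by move=> y _; exact: poweR_ge0.
by move=> y _; apply: ge0_le_poweR => //; exact: ltW.
Qed.

Lemma mixintZ (a : R) G : measurable_fun setT G -> (forall z, 0 <= G z) ->
  (0 <= a)%R -> mixint (fun z => a%:E * G z) = (a `^ p)%:E * mixint G.
Proof.
move=> mG G0 a0; rewrite -ge0_integralZl_EFin ?powR_ge0//=; last 2 first.
  by move=> x _; exact: poweR_ge0.
  exact: minner.
apply: eq_integral => x _.
have -> : \int[m2]_y ((a%:E * G (x, y)) `^ q) =
    (a `^ q)%:E * \int[m2]_y (G (x, y) `^ q).
  rewrite -ge0_integralZl_EFin ?powR_ge0//=; last 2 first.
    by move=> y _; exact: poweR_ge0.
    exact: mslice.
  by apply: eq_integral => y _; rewrite poweRM ?lee_fin.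
rewrite poweRM ?lee_fin ?powR_ge0// poweR_EFin -powRrM.
by rewrite mulrCA divff ?mulr1// gt_eqF.
Qed.

(** The inner sum costs [2 ^ q], which the outer power turns into [2 ^ p]; the outer sum costs
    [2 ^ (p / q)], at most [2 ^ p] because [q >= 1]. *)
Lemma mixintD_le G H : measurable_fun setT G -> measurable_fun setT H ->
  (forall z, 0 <= G z) -> (forall z, 0 <= H z) ->
  mixint (fun z => G z + H z) <= (4 `^ p)%:E * (mixint G + mixint H).
Proof.
move=> mG mH G0 H0; have mGH := emeasurable_funD mG mH.
rewrite -ge0_integralD//=; try (by move=> x _; exact: poweR_ge0); try exact: minner.
rewrite -ge0_integralZl_EFin ?powR_ge0//=; last 2 first.
  by move=> x _; rewrite adde_ge0 ?poweR_ge0.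
  by apply: emeasurable_funD; exact: minner.
apply: ge0_le_integral => //=.
- by move=> x _; exact: poweR_ge0.
- exact: minner mGH.
- by apply: measurable_funeM; apply: emeasurable_funD; exact: minner.
move=> x _.
have inner_le : \int[m2]_y ((G (x, y) + H (x, y)) `^ q) <=
    (2 `^ q)%:E * (\int[m2]_y (G (x, y) `^ q) + \int[m2]_y (H (x, y) `^ q)).
  rewrite -ge0_integralD//=; try (by move=> y _; exact: poweR_ge0); try exact: mslice.
  rewrite -ge0_integralZl_EFin ?powR_ge0//=; last 2 first.
    by move=> y _; rewrite adde_ge0 ?poweR_ge0.
    by apply: emeasurable_funD; exact: mslice.
  apply: ge0_le_integral => //=.
  - by move=> y _; exact: poweR_ge0.
  - exact: mslice mGH.
  - by apply: measurable_funeM; apply: emeasurable_funD; exact: mslice.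
  - by move=> y _; apply: poweR_add_le => //; exact: ltW.
apply: (le_trans (ge0_le_poweR (ltW pq0) _ inner_le)).
  by apply: integral_ge0 => y _; exact: poweR_ge0.
rewrite poweRM; [|by rewrite lee_fin powR_ge0|by rewrite adde_ge0].
rewrite poweR_EFin -powRrM mulrCA divff ?mulr1 ?gt_eqF//.
apply: (@le_trans _ _ ((2 `^ p)%:E * ((2 `^ (p / q))%:E *
   ((\int[m2]_y (G (x, y) `^ q)) `^ (p / q) +
    (\int[m2]_y (H (x, y) `^ q)) `^ (p / q))))).
  rewrite lee_pmul2l ?lte_fin ?powR_gt0//.
  by apply: poweR_add_le => //; exact: ltW.
rewrite muleA lee_pmul ?mule_ge0 ?adde_ge0 ?lee_fin ?powR_ge0 ?poweR_ge0//.
have -> : 4%R = (2 * 2)%R :> R by rewrite -natrM.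
rewrite powRM// ler_pM2l ?powR_gt0// ler_powR ?ler1n//.
by rewrite ler_pdivrMr// ler_peMr// ltW.
Qed.

(** Monotone convergence is applied twice, to the inner and then to the outer integral. It carries
    bounds on partial sums over to infinite series. *)
Lemma mixint_lim_le (G : nat -> X * Y -> \bar R) H (B : \bar R) :
  (forall n, measurable_fun setT (G n)) -> (forall n z, 0 <= G n z) ->
  (forall z, nondecreasing_seq (G ^~ z)) ->
  (forall z, G ^~ z @ \oo --> H z) ->
  (forall n, mixint (G n) <= B) -> mixint H <= B.
Proof.
move=> mG G0 ndG cG GB.
have cin x : (fun n => \int[m2]_y (G n (x, y) `^ q)) @ \oo --> \int[m2]_y (H (x, y) `^ q).
  have -> : \int[m2]_y (H (x, y) `^ q) = \int[m2]_y limn (fun n => G n (x, y) `^ q).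
    apply: eq_integral => y _; apply/esym/cvg_lim => //.
    exact: nd_poweR_cvg.
  apply: (cvg_monotone_convergence measurableT (g' := fun n y => G n (x, y) `^ q)).
  - by move=> n; exact: mslice.
  - by move=> n y _; exact: poweR_ge0.
  - by move=> y _ m n mn; apply: ge0_le_poweR => //; [exact: ltW|exact: ndG].
have ndin x : nondecreasing_seq (fun n => \int[m2]_y (G n (x, y) `^ q)).
  move=> m n mn; apply: ge0_le_integral => //=; try exact: mslice.
    by move=> y _; exact: poweR_ge0.
  by move=> y _; apply: ge0_le_poweR => //; [exact: ltW|exact: ndG].
have cout : (fun n => mixint (G n)) @ \oo --> mixint H.
  have -> : mixint H = \int[m1]_x limn (fun n => (\int[m2]_y (G n (x, y) `^ q)) `^ (p / q)).
    apply: eq_integral => x _; apply/esym/cvg_lim => //.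
    by apply: nd_poweR_cvg => // n; exact: inner_ge0.
  apply: (cvg_monotone_convergence measurableT
            (g' := fun n x => (\int[m2]_y (G n (x, y) `^ q)) `^ (p / q))).
  - by move=> n; exact: minner.
  - by move=> n y _; exact: poweR_ge0.
  - by move=> y _ m n mn; apply: ge0_le_poweR; [exact: ltW|exact: inner_ge0|exact: ndin].
rewrite -(cvg_lim _ cout)//; apply: lime_le; first by apply/cvg_ex; exists (mixint H).
by near=> n; exact: GB.
Unshelve. all: by end_near. Qed.

Lemma mixint_box (A : set X) (B : set Y) (a : R) : measurable A -> measurable B ->
  (0 <= a)%R ->
  mixint (fun z => (a * \1_A z.1 * \1_B z.2)%:E) =
  (a `^ p)%:E * (m1 A * m2 B `^ (p / q)).
Proof.
move=> mA mB a0.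
have mAB : measurable_fun setT (fun z : X * Y => ((\1_A z.1 * \1_B z.2)%R)%:E : \bar R).
  apply/measurable_EFinP; apply: measurable_funM.
    exact: (measurableT_comp (@measurable_indic _ _ _ _ _ mA) measurable_fst).
  exact: (measurableT_comp (@measurable_indic _ _ _ _ _ mB) measurable_snd).
under [X in mixint X]eq_fun do rewrite -mulrA EFinM.
rewrite mixintZ//.
congr (_ * _); rewrite /mixint.
transitivity (\int[m1]_x ((\1_A x)%:E * m2 B `^ (p / q))).
  apply: eq_integral => x _; rewrite indicE; case: (boolP (x \in A)) => xA.
    rewrite mul1e; congr (_ `^ _).
    rewrite -[B in RHS]setIT -integral_indic//.
    apply: eq_integral => y _; rewrite /= mul1r indicE.
    by case: (_ \in _); rewrite ?powR1 ?powR0 ?gt_eqF.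
  rewrite mul0e integral0_eq ?poweR0r ?gt_eqF//.
  by move=> y _; rewrite /= mul0r powR0 ?gt_eqF.
rewrite ge0_integralZr//; last 2 first.
- by apply/measurable_EFinP; exact: measurable_indic.
- exact: poweR_ge0.
- by rewrite integral_indic// setIT.
Qed.

End mixed_norm.

(** * Lebesgue measure of boxes and unit cells *)

Section fibers.
Context d (T : measurableType d) (R : realType) (I : countType).
Variables (mu : {measure set T -> \bar R}) (fl : T -> I).
Hypothesis mfl : forall i, measurable [set x | fl x = i].
Local Open Scope ereal_scope.

Lemma measurable_fun_countable_comp d' (T' : measurableType d') (h : I -> T') :
  measurable_fun setT (h \o fl).
Proof.
move=> _ Y mY; rewrite setTI.
rewrite (_ : _ @^-1` Y = \bigcup_n
  \bigcup_(i in [set i | pickle i = n /\ Y (h i)]) [set x | fl x = i]).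
  apply: bigcupT_measurable => n.
  have [[i [ni Yi]]|ne] := pselect (exists i, pickle i = n /\ Y (h i)).
    rewrite (_ : [set i | _] = [set i]) ?bigcup_set1//.
    apply/seteqP; split => [j /= [jn _]|j /= ->//].
    by apply: (pcan_inj (@pickleK_inv I)); rewrite jn ni.
  rewrite (_ : [set i | _] = set0) ?bigcup_set0//.
  by apply/seteqP; split => // j /= ?; apply: ne; exists j.
apply/seteqP; split => [x /= Yx|x [n _ [i /= [_ Yi]] xi]]; last by rewrite /= xi.
by exists (pickle (fl x)) => //; exists (fl x).
Qed.

Hypothesis mu_fl : forall i, mu [set x | fl x = i] = 1.

(** The fibers, numbered by [pickle], form a disjoint sequence covering the space; a number that
    codes no index gives an empty set and the term 0. *)
Lemma integral_fibers (h : I -> \bar R) : (forall i, 0 <= h i) ->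
  \int[mu]_x h (fl x) = \esum_(i in [set: I]) h i.
Proof.
move=> h0; pose F n := [set x | pickle (fl x) = n].
pose a (n : nat) : \bar R := if @pickle_inv I n is Some i then h i else 0.
have FE n : F n = if @pickle_inv I n is Some i then [set x | fl x = i] else set0.
  case E : (pickle_inv n) => [i|]; apply/seteqP; split => x //=.
  - by move=> nx; move: E; rewrite -nx pickleK_inv => -[].
  - by rewrite /F /= => ->; have := pickle_invK (T := I) n; rewrite E.
  - by move=> nx; move: E; rewrite -nx pickleK_inv.
have mF n : measurable (F n) by rewrite FE; case: pickle_inv.
have UF : \bigcup_n F n = setT.
  by apply/seteqP; split => // x _; exists (pickle (fl x)).
rewrite -UF ge0_integral_bigcup//; last 2 first.
- by rewrite UF; exact: (measurable_fun_countable_comp h).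
- by move=> i j _ _ [x [<- <-]].
transitivity (\sum_(n <oo) a n).
  apply: eq_eseriesr => n _; rewrite FE /a; case: (pickle_inv n) => [i|].
    transitivity (\int[mu]_(x in [set x | fl x = i]) (cst (h i) x)).
      by apply: eq_integral => x; rewrite inE /= => ->.
    by rewrite integral_cst// mu_fl mule1.
  by rewrite integral_set0.
rewrite nneseries_esumT; last by move=> n; rewrite /a; case: pickle_inv.
rewrite [RHS](eq_esum (b := a \o @pickle I)); last first.
  by move=> i _; rewrite /= /a pickleK_inv.
have bij : set_bij [set: I] (range (@pickle I)) (@pickle I).
  split => // i j _ _; exact: (pcan_inj (@pickleK_inv I)).
rewrite -[RHS](reindex_esum _ _ _ a bij).
rewrite [RHS]esum_mkcond; apply: eq_esum => n _.
case: ifPn => // /negP nr; rewrite /a; case E : (pickle_inv n) => [i|//].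
exfalso; apply: nr; rewrite inE; exists i => //.
by have := pickle_invK (T := I) n; rewrite E.
Qed.

End fibers.

Section boxes.
Context {R : realType}.

(** Half-open, so that the unit boxes with integer corners are exactly the fibers of [rV_floor] and
    tile the space. *)
Definition rV_box n (a : 'rV[R]_n) (r : R) : set 'rV[R]_n :=
  [set v | forall i, a ord0 i <= v ord0 i < a ord0 i + r].

Lemma measurable_rV_box n (a : 'rV[R]_n) (r : R) : measurable (rV_box a r).
Proof.
rewrite (_ : rV_box a r = \bigcap_(i in [set: 'I_n])
  ((fun v : 'rV[R]_n => v ord0 i) @^-1` `[a ord0 i, a ord0 i + r[)).
  apply: fin_bigcap_measurable => // i _.
  by rewrite -[X in measurable X]setTI; apply: measurable_coord.
apply/seteqP; split => [v vb i _|v vb i] /=; first by rewrite in_itv/=; exact: vb.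
by have := vb i I; rewrite /= in_itv.
Qed.

Lemma rV_cons0 n (z : measurableTypeR R * 'rV[R]_n) : rV_cons z ord0 ord0 = z.1.
Proof. by rewrite -{2}(rV_consK z). Qed.

Lemma rV_consS n (z : measurableTypeR R * 'rV[R]_n) i :
  rV_cons z ord0 (lift ord0 i) = z.2 ord0 i.
Proof. by rewrite -{2}(rV_consK z) /= mxE. Qed.

Lemma lebesgue_rV_box n (a : 'rV[R]_n) (r : R) : 0 <= r ->
  lebesgue_rV R n (rV_box a r) = (r ^+ n)%:E.
Proof.
move=> r0; elim: n a => [|n IH] a /=.
  rewrite diracE expr0 (_ : _ \in _ = true)//.
  by apply/mem_set => -[].
rewrite /lebesgue_rV_cons /pushforward.
have -> : rV_cons @^-1` rV_box a r =
    `[a ord0 ord0, a ord0 ord0 + r[ `*` rV_box (rV_uncons a).2 r.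
  apply/seteqP; split => -[x v] /=.
    move=> H; split => [|i] /=; first by have := H ord0; rewrite rV_cons0 in_itv.
    by have := H (lift ord0 i); rewrite rV_consS mxE.
  move=> [/= Hx Hv] i; case: (unliftP ord0 i) => [j ->|->].
    by have := Hv j; rewrite rV_consS mxE.
  by move: Hx; rewrite in_itv /= rV_cons0.
rewrite product_measure1E//; last exact: measurable_rV_box.
rewrite IH; transitivity
    ((@lebesgue_measure R `[a ord0 ord0, (a ord0 ord0 + r)%R[ * (r ^+ n)%:E)%E) => //.
rewrite lebesgue_measure_itv /= lte_fin.
case: ifPn => [_|]; first by rewrite -EFinB addrAC subrr add0r -EFinM exprS.
rewrite ltrDl -leNgt => r0'; have -> : r = 0 by apply/le_anti; rewrite r0 r0'.
by rewrite mul0e exprS mul0r.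
Qed.

Lemma floor_fiber (k : int) : [set x : R | Num.floor x = k] = `[k%:~R, k%:~R + 1[%classic.
Proof.
apply/seteqP; split => x /=; rewrite in_itv /=.
  by move=> <-; rewrite -intrD1 floor_itv.
by rewrite -intrD1 => H; exact: floor_def.
Qed.

Definition rV_floor n (v : 'rV[R]_n) : 'rV[int]_n := map_mx Num.floor v.

Lemma rV_floor_fiber n (k : 'rV[int]_n) :
  [set v | rV_floor v = k] = rV_box (map_mx intr k) 1.
Proof.
apply/seteqP; split => v /=.
  move=> <- i; rewrite !mxE.
  have : [set x | Num.floor x = Num.floor (v ord0 i)] (v ord0 i) by [].
  by rewrite floor_fiber /= in_itv.
move=> H; apply/rowP => i; rewrite mxE.
suff : [set x | Num.floor x = k ord0 i] (v ord0 i) by [].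
by rewrite floor_fiber /= in_itv /=; have := H i; rewrite mxE.
Qed.

End boxes.

(** * Complex moduli and measurability of complex-valued functions *)

Section complex_facts.
Context {R : realType}.
Local Notation normc := Normc.normc.
Implicit Types u v : R[i].

Lemma normc_ge0 u : 0 <= normc u.
Proof. by case: u => a b; exact: sqrtr_ge0. Qed.

Lemma normc_triangle u v : normc (u + v) <= normc u + normc v.
Proof. exact: le_normcD. Qed.

Lemma normc_opp u : normc (- u) = normc u. Proof. exact: normcN. Qed.

Lemma normc_distC u v : normc (u - v) = normc (v - u).
Proof. by rewrite -opprB normc_opp. Qed.

Lemma normc_sum (I : Type) (r : seq I) (F : I -> R[i]) :
  normc (\sum_(i <- r) F i) <= \sum_(i <- r) normc (F i).
Proof.
elim: r => [|i r IH]; first by rewrite !big_nil Normc.normc0.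
by rewrite !big_cons (le_trans (normc_triangle _ _))// lerD2l.
Qed.

Lemma normc_real (a : R) : normc (a%:C)%C = `|a|.
Proof. by rewrite /= expr0n /= addr0 sqrtr_sqr. Qed.

Lemma normc_Re u : `|complex.Re u| <= normc u.
Proof.
by case: u => a b /=; rewrite -sqrtr_sqr ler_wsqrtr// lerDl sqr_ge0.
Qed.

Lemma normc_Im u : `|complex.Im u| <= normc u.
Proof.
by case: u => a b /=; rewrite -sqrtr_sqr ler_wsqrtr// lerDr sqr_ge0.
Qed.

Lemma ReD u v : complex.Re (u + v) = complex.Re u + complex.Re v.
Proof. by case: u => a b; case: v. Qed.
Lemma ImD u v : complex.Im (u + v) = complex.Im u + complex.Im v.
Proof. by case: u => a b; case: v. Qed.

Lemma Re_sum (I : Type) (r : seq I) (F : I -> R[i]) :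
  complex.Re (\sum_(i <- r) F i) = \sum_(i <- r) complex.Re (F i).
Proof. by elim: r => [|i r IH]; rewrite ?big_nil// !big_cons ReD IH. Qed.

Lemma Im_sum (I : Type) (r : seq I) (F : I -> R[i]) :
  complex.Im (\sum_(i <- r) F i) = \sum_(i <- r) complex.Im (F i).
Proof. by elim: r => [|i r IH]; rewrite ?big_nil// !big_cons ImD IH. Qed.

Lemma normc_lim_le (u : nat -> R[i]) (a b : R) (v : R[i]) (B : R) :
  (fun n => complex.Re (u n)) @ \oo --> a ->
  (fun n => complex.Im (u n)) @ \oo --> b ->
  (\forall n \near \oo, normc (u n - v) <= B) -> normc ((a +i* b)%C - v) <= B.
Proof.
move=> ua ub [N _ uB].
have B0 : 0 <= B by apply: le_trans (normc_ge0 _) (uB N (leqnn N)).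
have c : (fun n =>
      (complex.Re (u n) - complex.Re v) * (complex.Re (u n) - complex.Re v) +
      (complex.Im (u n) - complex.Im v) * (complex.Im (u n) - complex.Im v)) @ \oo -->
    (a - complex.Re v) * (a - complex.Re v) + (b - complex.Im v) * (b - complex.Im v).
  by apply: cvgD; apply: cvgM; apply: cvgB => //; exact: cvg_cst.
have -> : normc ((a +i* b)%C - v) =
    Num.sqrt ((a - complex.Re v) * (a - complex.Re v) +
              (b - complex.Im v) * (b - complex.Im v)).
  by case: v {uB c} => v1 v2 /=; rewrite -!expr2.
rewrite -[leRHS](ger0_norm B0) -(sqrtr_sqr B) ler_wsqrtr//.
rewrite -(cvg_lim _ c)//; apply: limr_le; first by apply/cvg_ex; eexists; exact: c.
exists N => // n /uB {uB c}; case: (u n) v => x1 x2 [v1 v2] /=.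
rewrite -[leRHS](ger0_norm B0) -(sqrtr_sqr B) => H.
by rewrite -!expr2 -ler_sqrt ?sqr_ge0.
Qed.

End complex_facts.

Section cmeasurable_facts.
Context {R : realType} {d : nat}.
Local Notation pt := (R * 'rV[R]_d)%type.
Local Notation mpt := (measurableTypeR R * 'rV[R]_d)%type.
Local Notation normc := Normc.normc.
Implicit Types f g : pt -> R[i].

Lemma cmeasurableD f g : cmeasurable f -> cmeasurable g ->
  cmeasurable (fun z => f z + g z).
Proof.
move=> [f1 f2] [g1 g2]; split.
  by under eq_fun do rewrite ReD; exact: measurable_funD.
by under eq_fun do rewrite ImD; exact: measurable_funD.
Qed.

Lemma cmeasurableM f g : cmeasurable f -> cmeasurable g ->
  cmeasurable (fun z => f z * g z).
Proof.
move=> [f1 f2] [g1 g2]; split.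
  rewrite [X in measurable_fun _ X](_ : _ = (fun z => complex.Re (f z) * complex.Re (g z) -
     complex.Im (f z) * complex.Im (g z))).
    by apply: measurable_funB; exact: measurable_funM.
  by apply/funext => z; case: (f z) => ? ?; case: (g z).
rewrite [X in measurable_fun _ X](_ : _ = (fun z => complex.Re (f z) * complex.Im (g z) +
   complex.Im (f z) * complex.Re (g z))).
  by apply: measurable_funD; exact: measurable_funM.
by apply/funext => z; case: (f z) => ? ?; case: (g z).
Qed.

Lemma cmeasurable_cst (a : R[i]) : cmeasurable (fun _ : pt => a).
Proof. by split; exact: measurable_cst. Qed.

Lemma cmeasurableZ (a : R[i]) f : cmeasurable f -> cmeasurable (fun z => a * f z).
Proof. by move=> mf; apply: cmeasurableM => //; exact: cmeasurable_cst. Qed.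

Lemma cmeasurableN f : cmeasurable f -> cmeasurable (fun z => - f z).
Proof.
by move=> mf; under eq_fun do rewrite -mulN1r; exact: cmeasurableZ.
Qed.

Lemma cmeasurableB f g : cmeasurable f -> cmeasurable g ->
  cmeasurable (fun z => f z - g z).
Proof. by move=> mf mg; apply: cmeasurableD => //; exact: cmeasurableN. Qed.

Lemma cmeasurable_sum (I : Type) (r : seq I) (F : I -> pt -> R[i]) :
  (forall i, cmeasurable (F i)) -> cmeasurable (fun z => \sum_(i <- r) F i z).
Proof.
move=> mF; elim: r => [|i r IH].
  by under eq_fun do rewrite big_nil; exact: cmeasurable_cst.
by under eq_fun do rewrite big_cons; exact: cmeasurableD.
Qed.

Lemma cmeasurable_real (g : mpt -> R) : measurable_fun [set: mpt] g ->
  cmeasurable (fun z => (g z)%:C%C).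
Proof. by move=> mg; split => //; exact: measurable_cst. Qed.

Lemma measurable_normc f : cmeasurable f ->
  measurable_fun [set: mpt] (fun z => normc (f z)).
Proof.
move=> [f1 f2].
rewrite (_ : (fun z => _) = (@powR R ^~ 2^-1) \o
    (fun z => complex.Re (f z) ^+ 2 + complex.Im (f z) ^+ 2)).
  apply: measurableT_comp; first exact: measurable_powR.
  by apply: measurable_funD; exact: measurable_funX.
apply/funext => z /=; rewrite powR12_sqrt ?addr_ge0 ?sqr_ge0//.
by case: (f z).
Qed.

Lemma measurable_normcE f : cmeasurable f ->
  measurable_fun [set: mpt] (fun z => (normc (f z))%:E).
Proof. by move=> mf; apply/measurable_EFinP; exact: measurable_normc. Qed.

Lemma cmeasurable_comp (s : mpt -> mpt) f : measurable_fun [set: mpt] s ->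
  cmeasurable f -> cmeasurable (f \o s).
Proof.
move=> ms [f1 f2]; split.
  exact: (measurableT_comp f1 ms).
exact: (measurableT_comp f2 ms).
Qed.

Lemma measurable_translation (a : mpt) :
  measurable_fun [set: mpt] (fun z : mpt => (z.1 - a.1, z.2 - a.2) : mpt).
Proof.
apply/measurable_fun_pairP; split => /=.
  by apply: measurable_funB => //; exact: measurable_fst.
apply: measurable_fun_rV => i /=; under eq_fun do rewrite !mxE.
apply: measurable_funB => //.
exact: (measurableT_comp (measurable_coord i) measurable_snd).
Qed.

Lemma lebesgue_prod_aeS (A B : pt -> Prop) : (forall z, A z -> B z) ->
  {ae lebesgue_prod R d, forall z, A z} -> {ae lebesgue_prod R d, forall z, B z}.
Proof. by move=> AB; exact: (@filterS _ _ (ae_filter_ringOfSetsType _)). Qed.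

End cmeasurable_facts.

(** * Bounds and completeness in mixed-norm spaces *)

Section Lpq_bounds.
Context {R : realType} {d : nat} (p q : R).
Hypotheses (p1 : 1 <= p) (q1 : 1 <= q).
Local Notation pt := (R * 'rV[R]_d)%type.
Local Notation mpt := (measurableTypeR R * 'rV[R]_d)%type.
Local Notation normc := Normc.normc.
Implicit Types f g : pt -> R[i].
Local Notation Jpq := (mixint (@lebesgue_measure R) (lebesgue_rV R d) p q).

Let p0 : 0 < p. Proof. exact: lt_le_trans p1. Qed.
Let q0 : 0 < q. Proof. exact: lt_le_trans q1. Qed.

(** Membership in L^{p,q} and a real bound for the norm in one predicate: estimates then compose by
    real arithmetic, in the form that [open_mapping] expects of [bE] and [bF]. *)
Record Lpq_bound f (r : R) : Prop := LpqBound {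
  Lpq_bound_ge0 : 0 <= r;
  Lpq_bound_measurable : cmeasurable f;
  Lpq_bound_int : (Jpq (fun z => (normc (f z))%:E) <= (r `^ p)%:E)%E }.

Lemma Lpq_norm_le f (r : R) : 0 <= r ->
  (Lpq_norm p q f <= r%:E)%E = (Jpq (fun z => (normc (f z))%:E) <= (r `^ p)%:E)%E.
Proof.
move=> r0; rewrite /Lpq_norm -/(Jpq _); set j := Jpq _.
have j0 : (0 <= j)%E by exact: mixint_ge0.
apply/idP/idP => H.
  have := @ge0_le_poweR _ p _ _ (ltW p0) (poweR_ge0 _ _) H.
  by rewrite -poweRrM mulVf ?gt_eqF// poweRe1.
have ip0 : 0 <= p^-1 by rewrite invr_ge0 ltW.
have := @ge0_le_poweR _ p^-1 _ _ ip0 j0 H.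
by rewrite poweR_EFin -powRrM mulfV ?gt_eqF// powRr1.
Qed.

Lemma Lpq_boundE f r : cmeasurable f -> 0 <= r ->
  (Lpq_norm p q f <= r%:E)%E -> Lpq_bound f r.
Proof. by move=> mf r0; rewrite Lpq_norm_le. Qed.

Lemma Lpq_bound_norm f r : Lpq_bound f r -> (Lpq_norm p q f <= r%:E)%E.
Proof. by move=> [r0 _]; rewrite -Lpq_norm_le. Qed.

Lemma LpqP f : Lpq p q f <-> exists r, Lpq_bound f r.
Proof.
split=> [[mf fin]|[r [r0 mf b]]]; last first.
  split => //; apply: (@le_lt_trans _ _ r%:E); last exact: ltry.
  by rewrite Lpq_norm_le.
have n0 : (0 <= Lpq_norm p q f)%E by exact: poweR_ge0.
exists (fine (Lpq_norm p q f)); apply: Lpq_boundE => //; first exact: fine_ge0.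
by rewrite fineK// ge0_fin_numE.
Qed.

Lemma Lpq_bound_le f r s : r <= s -> Lpq_bound f r -> Lpq_bound f s.
Proof.
move=> rs [r0 mf b]; have s0 := le_trans r0 rs; split => //.
by apply: (le_trans b); rewrite lee_fin ge0_ler_powR// ltW.
Qed.

Lemma Lpq_bound_dom f g r : cmeasurable g -> (forall z, normc (g z) <= normc (f z)) ->
  Lpq_bound f r -> Lpq_bound g r.
Proof.
move=> mg gf [r0 mf b]; split; [exact: r0|exact: mg|]; apply: le_trans b.
apply: le_mixint; [exact: p1|exact: q1|exact: measurable_normcE|exact: measurable_normcE| |].
  by move=> z; rewrite lee_fin normc_ge0.
by move=> z; rewrite lee_fin.
Qed.

Lemma Lpq_boundZ (a : R[i]) f r : Lpq_bound f r ->
  Lpq_bound (fun z => a * f z) (normc a * r).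
Proof.
move=> [r0 mf b]; split; first by rewrite mulr_ge0 ?normc_ge0.
  exact: cmeasurableZ.
under [X in mixint _ _ _ _ X]eq_fun do rewrite Normc.normcM EFinM.
rewrite mixintZ//; [|exact: measurable_normcE| |exact: normc_ge0]; last first.
  by move=> z; rewrite lee_fin normc_ge0.
rewrite powRM ?normc_ge0// EFinM lee_pmul//; first by rewrite lee_fin powR_ge0.
exact: mixint_ge0.
Qed.

Lemma Lpq_boundN f r : Lpq_bound f r -> Lpq_bound (fun z => - f z) r.
Proof.
move=> bf; apply: (Lpq_bound_dom _ _ bf).
  by apply: cmeasurableN; case: bf.
by move=> z; rewrite normc_opp.
Qed.

(* A quasi-triangle inequality suffices throughout, so Minkowski's inequality is avoided. *)
Lemma Lpq_boundD f g r s : Lpq_bound f r -> Lpq_bound g s ->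
  Lpq_bound (fun z => f z + g z) (8 * (r + s)).
Proof.
move=> [r0 mf bf] [s0 mg bg].
have rs0 : 0 <= r + s by exact: addr_ge0.
split; [by rewrite mulr_ge0|exact: cmeasurableD|].
have mf' := measurable_normcE mf; have mg' := measurable_normcE mg.
apply: (@le_trans _ _ (Jpq (fun z => (normc (f z))%:E + (normc (g z))%:E)%E)).
  apply: le_mixint; [exact: p1|exact: q1| | | |].
  - by apply: measurable_normcE; exact: cmeasurableD.
  - exact: emeasurable_funD.
  - by move=> z; rewrite lee_fin normc_ge0.
  - by move=> z; rewrite -EFinD lee_fin normc_triangle.
apply: le_trans (mixintD_le _ _ p1 q1 mf' mg' _ _) _;
  try by move=> z; rewrite lee_fin normc_ge0.
(* The factor 4 comes from [mixintD_le]; the factor 2 absorbs the two copies of [(r + s) ^ p], since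
   [2 <= 2 ^ p]. *)
have -> : 8 = 4 * 2 :> R by rewrite -natrM.
rewrite -mulrA powRM ?mulr_ge0// EFinM lee_pmul2l ?lte_fin ?powR_gt0//.
apply: (@le_trans _ _ ((r + s) `^ p + (r + s) `^ p)%:E).
  have pow_le t : 0 <= t -> t <= r + s -> t `^ p <= (r + s) `^ p.
    by move=> t0 ts; apply: ge0_ler_powR => //; exact: ltW.
  rewrite EFinD; apply: leeD.
    by apply: (le_trans bf); rewrite lee_fin pow_le// lerDl.
  by apply: (le_trans bg); rewrite lee_fin pow_le// lerDr.
rewrite lee_fin powRM// -mulr2n -[_ *+ 2]mulr_natl ler_wpM2r ?powR_ge0//.
by rewrite -{1}(powRr1 (ler0n R 2)) ler_powR ?ler1n.
Qed.

Lemma Lpq_boundB f g r s : Lpq_bound f r -> Lpq_bound g s ->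
  Lpq_bound (fun z => f z - g z) (8 * (r + s)).
Proof. by move=> bf bg; exact: (Lpq_boundD bf (Lpq_boundN bg)). Qed.

Lemma Lpq_bound0 : Lpq_bound (fun=> 0) 0.
Proof.
split; [by []|exact: cmeasurable_cst|].
rewrite powR0 ?gt_eqF// /mixint integral0_eq// => x _.
rewrite integral0_eq ?poweR0r ?gt_eqF ?divr_gt0// => y _.
by rewrite Normc.normc0 poweR0r ?gt_eqF.
Qed.

(** By Tonelli the inner integrals of [|g - f| ^ q] vanish for almost every [x], so [g - f] has norm
    0; adding [f] back costs the factor 8. *)
Lemma Lpq_bound_ae f g r : cmeasurable g -> cae_eq f g -> Lpq_bound f r ->
  Lpq_bound g (8 * r).
Proof.
move=> mg fg [r0 mf b].
pose h (z : mpt) := (normc (g z - f z))%:E.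
have mh : measurable_fun [set: mpt] h by apply: measurable_normcE; exact: cmeasurableB.
pose hq z := (h z `^ q)%E.
have mhq : measurable_fun [set: mpt] hq by exact: (measurableT_comp (measurable_poweR q)).
have hq0 z : (0 <= hq z)%E by exact: poweR_ge0.
have I0 : (\int[@lebesgue_measure R]_x fubini_F (lebesgue_rV R d) hq x = 0)%E.
  rewrite -(fubini_tonelli1 hq mhq hq0).
  rewrite (ae_eq_integral (cst 0%E) hq)//; first by rewrite integral0.
  apply: lebesgue_prod_aeS fg.
  move=> z /= fgz _.
  by rewrite /hq /h fgz subrr Normc.normc0 poweR0r// gt_eqF.
have mF := measurable_fun_fubini_tonelli_F (m2 := lebesgue_rV R d) hq mhq hq0.
have F0 x : (0 <= fubini_F (lebesgue_rV R d) hq x)%E by exact: integral_ge0.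
have J0 : Jpq h = 0%E.
  transitivity (\int[@lebesgue_measure R]_x (cst 0%E x : \bar R))%E; last by rewrite integral0.
  apply: ae_eq_integral => //.
    have mpF := measurableT_comp (measurable_poweR (p / q)) mF.
    exact: mpF.
  have : ae_eq (@lebesgue_measure R) setT (fubini_F (lebesgue_rV R d) hq) (cst 0%E).
    apply/(ae_eq_integral_abs _ measurableT mF); rewrite -[RHS]I0.
    by apply: eq_integral => x _; rewrite gee0_abs.
  apply: filterS => x /= Fx _; have := Fx I; rewrite /fubini_F => ->.
  by rewrite poweR0r// gt_eqF// divr_gt0.
have b0 : Lpq_bound (fun z => g z - f z) 0.
  split; [by []|exact: cmeasurableB|].
  by rewrite -/h J0 powR0 ?gt_eqF.
have := Lpq_boundD b0 (LpqBound r0 mf b); rewrite add0r.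
by under eq_fun do rewrite subrK.
Qed.

(** Chebyshev's inequality on a cube. It is how norm bounds yield pointwise ones, for coefficients
    in [Lpq_bound_coef] and for continuous functions in [synth_eq0]. *)
Lemma Lpq_bound_box f r (a : mpt) (e eta : R) : 0 <= e -> 0 <= eta ->
  (forall z : mpt, a.1 <= z.1 < a.1 + e -> rV_box a.2 e z.2 -> eta <= normc (f z)) ->
  Lpq_bound f r -> eta `^ p * (e * (e ^+ d) `^ (p / q)) <= r `^ p.
Proof.
move=> e0 eta0 H [r0 mf b].
have mA : measurable (`[a.1, a.1 + e[ : set (measurableTypeR R)) by exact: measurable_itv.
have mB := measurable_rV_box a.2 e.
rewrite -lee_fin; apply: le_trans b.
have -> : ((eta `^ p * (e * (e ^+ d) `^ (p / q)))%:E =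
    Jpq (fun z : mpt => (eta * \1_(`[a.1, (a.1 + e)%R[ : set R) z.1 *
                 \1_(rV_box a.2 e) z.2)%:E))%E.
  rewrite mixint_box// lebesgue_rV_box//.
  have lebA : lebesgue_measure (`[a.1, a.1 + e[ : set (measurableTypeR R)) = e%:E.
    rewrite lebesgue_measure_itv /= lte_fin ltrDl.
    have [_|] := ltP 0 e; first by rewrite -EFinB addrAC subrr add0r.
    by move=> e0'; congr EFin; apply/le_anti; rewrite e0 e0'.
  by rewrite [X in (_ * (X * _))%E]lebA poweR_EFin !EFinM.
apply: le_mixint; [exact: p1|exact: q1| | | |].
- apply/measurable_EFinP; apply: measurable_funM.
    apply: measurable_funM => //.
    exact: (measurableT_comp (@measurable_indic _ _ _ _ _ mA) measurable_fst).
  exact: (measurableT_comp (@measurable_indic _ _ _ _ _ mB) measurable_snd).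
- exact: measurable_normcE.
- by move=> z; rewrite lee_fin !mulr_ge0.
move=> z; rewrite lee_fin !indicE.
have [zA|_] := boolP (_ \in _); last by rewrite mulr0 mul0r normc_ge0.
have [zB|_] := boolP (_ \in _); last by rewrite mulr0 normc_ge0.
rewrite !mulr1; apply: H; last exact: set_mem zB.
by have := set_mem zA; rewrite /= in_itv.
Qed.

End Lpq_bounds.

(** * Sums of rapidly decreasing series *)

Section Lpq_complete.
Context {R : realType} {d : nat} (p q : R).
Hypotheses (p1 : 1 <= p) (q1 : 1 <= q).
Local Notation pt := (R * 'rV[R]_d)%type.
Local Notation mpt := (measurableTypeR R * 'rV[R]_d)%type.
Local Notation normc := Normc.normc.
Local Notation Jpq := (mixint (@lebesgue_measure R) (lebesgue_rV R d) p q).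
Local Notation Lpq_bound := (@Lpq_bound R d p q).

(** A total substitute for the limit: upper limits are measurable whether or not the sequence
    converges, and agree with the limit when it does. *)
Definition clim (u : nat -> R[i]) : R[i] :=
  ((fine (limn_esup (fun n => (complex.Re (u n))%:E))) +i*
   (fine (limn_esup (fun n => (complex.Im (u n))%:E))))%C.

Lemma fine_limn_esup (u : nat -> R) (l : R) : u @ \oo --> l ->
  fine (limn_esup (EFin \o u)) = l.
Proof.
move=> ul; have /cvg_limn_einf_sup[_ ->] // : (EFin \o u) @ \oo --> l%:E.
by apply/fine_cvgP; split => //; near=> n.
Unshelve. all: by end_near. Qed.

Lemma cmeasurable_clim (f : nat -> pt -> R[i]) : (forall n, cmeasurable (f n)) ->
  cmeasurable (fun z => clim (f ^~ z)).
Proof.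
move=> mf; split.
  apply: (measurableT_comp (f := fine)); first exact: fine_measurable.
  apply: measurable_fun_limn_esup => n; apply/measurable_EFinP.
  by case: (mf n).
apply: (measurableT_comp (f := fine)); first exact: fine_measurable.
apply: measurable_fun_limn_esup => n; apply/measurable_EFinP.
by case: (mf n).
Qed.

(** Where the series of moduli diverges the right-hand side is infinite, so the bound holds at every
    point with no exceptional set; elsewhere the series converges absolutely. *)
Lemma clim_sub_le (v : nat -> R[i]) n :
  ((normc (clim (fun m => \sum_(k < m) v k) - \sum_(k < n) v k))%:E <=
   \sum_(0 <= j <oo) (normc (v (n + j)%N))%:E)%E.
Proof.
set H := (\sum_(0 <= j <oo) _)%E.
have H0 : (0 <= H)%E by apply: nneseries_ge0 => j _ _; rewrite lee_fin normc_ge0.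
have [Hoo|Hfin] := eqVneq H +oo%E; first by rewrite Hoo leey.
have Hf : H \is a fin_num by rewrite ge0_fin_numE// ltey.
pose w k := normc (v k).
have w0 k : 0 <= w k by exact: normc_ge0.
have part m : \sum_(k < m) w (n + k)%N <= fine H.
  rewrite -lee_fin fineK// -sumEFin.
  rewrite -(big_mkord xpredT (fun k => (w (n + k)%N)%:E)).
  by apply: nneseries_lim_ge => k _ _; rewrite lee_fin.
have split_sum m : (n <= m)%N -> \sum_(n <= k < m) w k <= fine H.
  move=> nm; apply: le_trans (part (m - n)%N).
  rewrite -{1}(add0n n) big_addn big_mkord.
  by under [leRHS]eq_bigr do rewrite addnC.
have wbnd m : series w m <= series w n + fine H.
  have ndw : nondecreasing_seq (series w) by apply: nondecreasing_series => k _ _; exact: w0.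
  have [mn|/ltnW nm] := leqP m n.
    by apply: (le_trans (ndw _ _ mn)); rewrite lerDl fine_ge0.
  by rewrite /series/= (big_cat_nat (leq0n n) nm) /= lerD2l split_sum.
have cw : cvgn (series w).
  apply: nondecreasing_is_cvgn; first by apply: nondecreasing_series => k _ _; exact: w0.
  by exists (series w n + fine H) => _ [m _ <-]; exact: wbnd.
have csub (u : nat -> R) : (forall k, `|u k| <= w k) -> cvgn (series u).
  move=> uw; apply: normed_cvg.
  exact: (@series_le_cvg _ (fun k => `|u k|) w (fun k => normr_ge0 _) w0 uw cw).
have /cvg_ex[/= a ca] := csub (fun k => complex.Re (v k)) (fun k => normc_Re _).
have /cvg_ex[/= b cb] := csub (fun k => complex.Im (v k)) (fun k => normc_Im _).
have ca' : (fun m => complex.Re (\sum_(k < m) v k)) @ \oo --> a.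
  by under eq_fun do rewrite Re_sum -(big_mkord xpredT (fun k => complex.Re (v k))).
have cb' : (fun m => complex.Im (\sum_(k < m) v k)) @ \oo --> b.
  by under eq_fun do rewrite Im_sum -(big_mkord xpredT (fun k => complex.Im (v k))).
have -> : clim (fun m => \sum_(k < m) v k) = (a +i* b)%C.
  by rewrite /clim; congr (_ +i* _)%C; exact: fine_limn_esup.
rewrite -(fineK Hf) lee_fin; apply: (normc_lim_le ca' cb').
exists n => // m /= nm; rewrite -!(big_mkord xpredT v).
rewrite (big_cat_nat (leq0n n) nm) /= addrAC subrr add0r.
apply: le_trans (normc_sum _ _) _.
exact: split_sum.
Qed.

(** A quantitative Riesz-Fischer theorem. Peeling off the first term of a finite tail gives
    [8 * (r n + 16 * r n.+1) <= 16 * r n], so the bound 16 survives any number of terms and then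
    passes to the monotone limit. *)
Lemma Lpq_complete (v : nat -> pt -> R[i]) (r : nat -> R) :
  (forall k, r k.+1 <= 16^-1 * r k) -> (forall k, Lpq_bound (v k) (r k)) ->
  forall n, Lpq_bound
    (fun z => clim (fun m => \sum_(k < m) v k z) - \sum_(k < n) v k z) (16 * r n).
Proof.
move=> rr bv n.
have r0 k : 0 <= r k by case: (bv k).
have mv k : cmeasurable (v k) by case: (bv k).
have bS m : Lpq_bound (fun z => (\sum_(j < m) normc (v (n + j)%N z))%:C%C) (16 * r n).
  elim: m n => [|m IH] n'.
    rewrite (_ : (fun z => _) = fun=> 0); last by apply/funext => z; rewrite big_ord0.
    by apply: (Lpq_bound_le p1 _ (Lpq_bound0 p1 q1)); rewrite mulr_ge0.
  have bn : Lpq_bound (fun z => (normc (v n' z))%:C%C) (r n').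
    apply: (Lpq_bound_dom p1 q1 _ _ (bv n')).
      by apply: cmeasurable_real; exact: measurable_normc.
    by move=> z; rewrite normc_real ger0_norm ?normc_ge0.
  have bb := Lpq_boundD p1 q1 bn (IH n'.+1).
  rewrite (_ : (fun z => _) = (fun z : pt => (normc (v n' z))%:C%C +
      (\sum_(j < m) normc (v (n'.+1 + j)%N z))%:C%C)); last first.
    apply/funext => z; rewrite big_ord_recl addn0 rmorphD; congr (_ + (_)%:C%C).
    by apply: eq_bigr => j _; rewrite addSnnS.
  by apply: (Lpq_bound_le p1 _ bb); have := rr n'; have := r0 n'; lra.
have mdiff : cmeasurable (fun z => clim (fun m => \sum_(k < m) v k z) - \sum_(k < n) v k z).
  apply: cmeasurableB; last exact: cmeasurable_sum.
  by apply: cmeasurable_clim => m; exact: cmeasurable_sum.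
split => //; first by rewrite mulr_ge0.
pose H (z : mpt) := (\sum_(0 <= j <oo) (normc (v (n + j)%N z))%:E)%E.
apply: (@le_trans _ _ (Jpq H)).
  apply: le_mixint; [exact: p1|exact: q1| | | |].
  - exact: measurable_normcE.
  - apply: ge0_emeasurable_sum => [k x _ _|k _]; first by rewrite lee_fin normc_ge0.
    exact: measurable_normcE.
  - by move=> z; rewrite lee_fin normc_ge0.
  - by move=> z; exact: (clim_sub_le (v ^~ z) n).
apply: (mixint_lim_le p1 q1
  (G := fun m (z : mpt) => (\sum_(j < m) normc (v (n + j)%N z))%:E)).
- move=> m; apply/measurable_EFinP; apply: measurable_sum => j; exact: measurable_normc.
- by move=> m z; rewrite lee_fin sumr_ge0// => j _; exact: normc_ge0.
- move=> z m m' mm'; rewrite lee_fin -!(big_mkord xpredT (fun j => normc (v (n + j)%N z))).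
  by rewrite [leRHS](big_cat_nat (leq0n m) mm') /= lerDl sumr_ge0// => j _; exact: normc_ge0.
- move=> z; rewrite /H.
  have := @is_cvg_nneseries R (fun j => (normc (v (n + j)%N z))%:E) xpredT 0%N.
  under eq_fun do rewrite big_mkord sumEFin.
  by apply=> j _ _; rewrite lee_fin normc_ge0.
- move=> m; have := Lpq_bound_int (bS m).
  rewrite (_ : (fun z => _) = (fun z : mpt => (\sum_(j < m) normc (v (n + j)%N z))%:E))//.
  apply/funext => z; rewrite normc_real ger0_norm// sumr_ge0// => j _.
  exact: normc_ge0.
Qed.

End Lpq_complete.

(** * Coefficient sequences as step functions *)

Section step_functions.
Context {R : realType} {d : nat} (p q : R).
Hypotheses (p1 : 1 <= p) (q1 : 1 <= q).
Local Notation pt := (R * 'rV[R]_d)%type.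
Local Notation mpt := (measurableTypeR R * 'rV[R]_d)%type.
Local Notation normc := Normc.normc.
Local Notation Jpq := (mixint (@lebesgue_measure R) (lebesgue_rV R d) p q).
Local Notation Lpq_bound := (@Lpq_bound R d p q).
Local Notation coef := (int -> 'rV[int]_d -> R[i]).
Implicit Types c : coef.

(** An isometric embedding of l^{p,q} into L^{p,q}, since the cells have measure 1 in each of the
    two variables. *)
Definition cstep c : pt -> R[i] := fun z => c (Num.floor z.1) (rV_floor z.2).

Let mfloor (i : int) :
  measurable ([set x | Num.floor x = i] : set (measurableTypeR R)).
Proof. by rewrite floor_fiber; exact: measurable_itv. Qed.

Let mrV_floor (i : 'rV[int]_d) : measurable [set x : 'rV[R]_d | rV_floor x = i].
Proof. by rewrite rV_floor_fiber; exact: measurable_rV_box. Qed.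

Lemma cmeasurable_cstep c : cmeasurable (cstep c).
Proof.
pose fl (z : mpt) := (Num.floor z.1, rV_floor z.2).
have mfl i : measurable [set z | fl z = i].
  rewrite (_ : [set z | _] = [set x | Num.floor x = i.1] `*` [set y | rV_floor y = i.2]).
    exact: measurableX.
  by apply/seteqP; split => z /=; rewrite /fl; case: i => i1 i2 /= [-> ->].
split.
  exact: (measurable_fun_countable_comp mfl (fun k => complex.Re (c k.1 k.2))).
exact: (measurable_fun_countable_comp mfl (fun k => complex.Im (c k.1 k.2))).
Qed.

Lemma mixint_cstep c : Jpq (fun z => (normc (cstep c z))%:E) =
  (\esum_(k1 in [set: int])
    (\esum_(k2 in [set: 'rV[int]_d]) (normc (c k1 k2) `^ q)%:E) `^ (p / q))%E.
Proof.
have mu1 i : lebesgue_measure ([set x | Num.floor x = i] : set (measurableTypeR R)) = 1%E.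
  rewrite floor_fiber lebesgue_measure_itv /= lte_fin ltrDl ltr01.
  by rewrite -EFinB addrAC subrr add0r.
have mud i : lebesgue_rV R d [set y | rV_floor y = i] = 1%E.
  by rewrite rV_floor_fiber lebesgue_rV_box// expr1n.
rewrite -(integral_fibers mfloor mu1); last by move=> i; exact: poweR_ge0.
apply: eq_integral => x _; congr (_ `^ _)%E.
by rewrite -(integral_fibers mrV_floor mud)// => i; rewrite lee_fin powR_ge0.
Qed.

Lemma lpqP c : (lpq_norm p q c < +oo)%E <-> exists r, Lpq_bound (cstep c) r.
Proof.
have -> : lpq_norm p q c = Lpq_norm p q (cstep c).
  by rewrite /lpq_norm -mixint_cstep.
rewrite -LpqP//; split=> [fin|[]//]; split => //; exact: cmeasurable_cstep.
Qed.

Lemma Lpq_bound_shift c r (m1 : int) (m2 : 'rV[int]_d) : Lpq_bound (cstep c) r ->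
  Lpq_bound (cstep (fun k1 k2 => c (k1 - m1) (k2 - m2))) r.
Proof.
move=> [r0 _ b]; split; [exact: r0|exact: cmeasurable_cstep|].
move: b; rewrite !mixint_cstep.
have bij (G : zmodType) (m : G) : set_bij setT setT (fun x : G => x - m).
  by split => // [x y _ _ /addIr|y _ /=] //; exists (y + m); rewrite ?addrK.
rewrite (reindex_esum _ _ _ _ (bij _ m1)).
under eq_esum do rewrite (reindex_esum _ _ _ _ (bij _ m2)).
exact.
Qed.

Lemma Lpq_bound_coef c r k1 k2 : Lpq_bound (cstep c) r -> normc (c k1 k2) <= r.
Proof.
move=> b; have r0 := Lpq_bound_ge0 b.
have := @Lpq_bound_box _ _ _ _ p1 q1 _ _ (k1%:~R, map_mx intr k2) 1 (normc (c k1 k2)).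
rewrite expr1n powR1 !mulr1 => /(_ (cstep c) r ler01 (normc_ge0 _)) H.
have p0 : 0 < p by exact: lt_le_trans p1.
have {}H : normc (c k1 k2) `^ p <= r `^ p.
  apply: H b => z /= z1 z2; rewrite /cstep.
  have -> : Num.floor z.1 = k1 by apply: floor_def; rewrite intrD1.
  suff -> : rV_floor z.2 = k2 by [].
  have : [set v | rV_floor v = k2] z.2 by rewrite rV_floor_fiber.
  by [].
rewrite leNgt; apply/negP => /(gt0_ltr_powR p0); rewrite !nnegrE r0 normc_ge0.
by move=> /(_ isT isT); rewrite ltNge H.
Qed.

(** [clim] acts pointwise, so the limit of step functions is the step function of the
    coefficientwise limit. *)
Lemma lpq_complete (e : nat -> coef) (r : nat -> R) :
  (forall k, r k.+1 <= 16^-1 * r k) -> (forall k, Lpq_bound (cstep (e k)) (r k)) ->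
  exists s : coef, forall n, Lpq_bound (cstep (s - \sum_(k < n) e k)) (16 * r n).
Proof.
move=> rr be; exists (fun k1 k2 => clim (fun m => \sum_(k < m) e k k1 k2)) => n.
have := Lpq_complete p1 q1 rr be n.
rewrite (_ : (fun z => _) = cstep ((fun k1 k2 => clim (fun m => \sum_(k < m) e k k1 k2)) -
    \sum_(k < n) e k))//.
apply/funext => z; rewrite /cstep.
have <- // : (\sum_(k < n) e k) (Num.floor z.1) (rV_floor z.2) =
          \sum_(k < n) e k (Num.floor z.1) (rV_floor z.2).
by rewrite !fct_sumE.
Qed.

End step_functions.

(** * Synthesis from integer shifts *)

Section csum_finite.
Context {R : realType}.

(** The partial sums are constant on all finite sets that contain [s]. *)
Lemma csum_seq (I : choiceType) (F : I -> R[i]) (s : seq I) : uniq s ->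
  (forall i, i \notin s -> F i = 0) -> csum F = \sum_(i <- s) F i.
Proof.
move=> us F0; rewrite /csum /summability.sum.
apply: (@cvg_lim R[i]^o (@norm_hausdorff _ R[i]^o) _ _ summability.totally_filter).
apply: (@cvg_near_cst _ _ _ _ _ summability.totally_filter).
exists (finmap.seq_fset tt s) => // A /= sA.
rewrite /summability.partial_sum -(finmap.big_seq_fsetE _ A xpredT F) /=.
rewrite (bigID (mem s)) /= [X in _ + X]big1 ?addr0; last by move=> i /F0.
rewrite -big_filter; apply: perm_big; apply: uniq_perm => //.
  by rewrite filter_uniq// finmap.fset_uniq.
move=> i; rewrite mem_filter; case: (boolP (i \in s)) => //= si.
by apply: (finmap.fsubsetP sA); have := finmap.seq_fsetE tt s i; rewrite si.
Qed.

Lemma esum_seq (I : choiceType) (F : I -> \bar R) (s : seq I) : uniq s ->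
  (forall i, 0 <= F i)%E -> (forall i, i \notin s -> F i = 0%E) ->
  (\esum_(i in [set: I]) F i = \sum_(i <- s) F i)%E.
Proof.
move=> us Fge F0; have fs : finite_set [set` s] by exact: finite_seq.
transitivity (\esum_(i in [set` s]) F i)%E.
  rewrite [RHS]esum_mkcond; apply: eq_esum => i _.
  by case: ifPn => // /negP si; apply: F0; apply/negP => h; apply: si; exact/mem_set.
by rewrite esum_fset// -fsbig_seq.
Qed.

(** The finite set of active indices varies with the point, so [I] is exhausted by the indices of
    code less than [n]; at each point these sums are eventually constant. *)
Lemma cmeasurable_csum d (I : countType) (F : I -> R * 'rV[R]_d -> R[i]) :
  (forall i, cmeasurable (F i)) ->
  (forall z, exists s : seq I, forall i, i \notin s -> F i z = 0) ->
  cmeasurable (fun z => csum (F ^~ z)).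
Proof.
move=> mF fF.
pose s n : seq I := pmap pickle_inv (iota 0 n).
have us n : uniq (s n).
  by apply: (pmap_uniq (@pickle_invK I)); exact: iota_uniq.
have mem_s n i : (i \in s n) = (@pickle I i < n)%N.
  rewrite mem_pmap; apply/mapP/idP => [[m]|lt].
    rewrite mem_iota add0n /= => lt im; have := @pickle_invK I m.
    by rewrite -im /= => ->.
  by exists (@pickle I i); rewrite ?mem_iota// pickleK_inv.
have ev z : \forall n \near \oo, \sum_(i <- s n) F i z = csum (F ^~ z).
  have [t ht] := fF z.
  exists (\max_(i <- t) @pickle I i).+1 => // n /= tn.
  apply/esym/csum_seq => // i; rewrite mem_s -leqNgt => ni; apply: ht.
  apply/negP => it; have := leq_trans tn ni.
  by rewrite ltnNge (@leq_bigmax_seq _ _ xpredT).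
split.
  apply: (@measurable_fun_cvg _ _ _ _ (fun n z => complex.Re (\sum_(i <- s n) F i z))).
    by move=> n; have [] := cmeasurable_sum (s n) mF.
  move=> z _; apply: cvg_near_cst; apply: filterS (ev z) => n.
  by move=> ->.
apply: (@measurable_fun_cvg _ _ _ _ (fun n z => complex.Im (\sum_(i <- s n) F i z))).
  by move=> n; have [] := cmeasurable_sum (s n) mF.
move=> z _; apply: cvg_near_cst; apply: filterS (ev z) => n.
by move=> ->.
Qed.

End csum_finite.

(** * Finite boxes of integer shifts *)

Section integer_boxes.
Variable n : nat.

Definition int_of_box (j : 'I_(n.*2.+1)) : int := (j : nat)%:Z - n%:Z.

Lemma int_of_box_inj : injective int_of_box.
Proof. by move=> i j /addIr [] /val_inj. Qed.

Lemma int_of_box_surj (m : int) : `|m| <= n%:Z -> exists j, int_of_box j = m.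
Proof.
rewrite ler_norml => /andP[m1 m2].
have m0 : 0 <= m + n%:Z by rewrite -lerBlDr sub0r.
have lt : (absz (m + n%:Z)%R < n.*2.+1)%N.
  by rewrite ltnS -lez_nat gez0_abs// -addnn PoszD lerD2r.
by exists (Ordinal lt); rewrite /int_of_box /= gez0_abs// addrK.
Qed.

Definition rV_of_box d (v : 'rV['I_(n.*2.+1)]_d) : 'rV[int]_d := map_mx int_of_box v.

Lemma rV_of_box_inj d : injective (@rV_of_box d).
Proof.
move=> u v uv; apply/rowP => i; apply: int_of_box_inj.
by have := congr1 (fun w : 'rV_d => w ord0 i) uv; rewrite !mxE.
Qed.

Lemma rV_of_box_surj d (m : 'rV[int]_d) : (forall i, `|m ord0 i| <= n%:Z) ->
  exists j, rV_of_box j = m.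
Proof.
move=> mn; have /choice[j jm] i := int_of_box_surj (mn i).
by exists (\row_i j i); apply/rowP => i; rewrite !mxE.
Qed.

Lemma csum_int_box (R : realType) (F : int -> R[i]) (a : int) :
  (forall k : int, n%:Z < `|a - k| -> F k = 0) ->
  csum F = \sum_(j : 'I_(n.*2.+1)) F (a - int_of_box j).
Proof.
move=> F0; rewrite (csum_seq (s := [seq a - int_of_box j | j : 'I_(n.*2.+1)])).
- by rewrite big_image.
- rewrite map_inj_uniq ?enum_uniq// => i j /addrI /oppr_inj; exact: int_of_box_inj.
move=> k nk; apply: F0; rewrite ltNge; apply/negP => /int_of_box_surj[j jk].
by case/negP: nk; apply/mapP; exists j; rewrite ?mem_enum// jk opprB addrC subrK.
Qed.

Lemma csum_rV_box (R : realType) d (F : 'rV[int]_d -> R[i]) (a : 'rV[int]_d) :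
  (forall (k : 'rV[int]_d) i, n%:Z < `|a ord0 i - k ord0 i| -> F k = 0) ->
  csum F = \sum_(j : 'rV['I_(n.*2.+1)]_d) F (a - rV_of_box j).
Proof.
move=> F0; rewrite (csum_seq (s := [seq a - rV_of_box j | j : 'rV['I_(n.*2.+1)]_d])).
- by rewrite big_image.
- rewrite map_inj_uniq ?enum_uniq// => i j /addrI /oppr_inj; exact: rV_of_box_inj.
move=> k nk; apply: contrapT => Fk; case/negP: nk; apply/mapP.
have [|j jk] := @rV_of_box_surj d (a - k).
  move=> i; rewrite !mxE leNgt; apply/negP => /F0; exact: Fk.
by exists j; rewrite ?mem_enum// jk opprB addrC subrK.
Qed.

End integer_boxes.

Section synthesis.
Context {R : realType} {d : nat}.
Local Notation pt := (R * 'rV[R]_d)%type.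
Local Notation mpt := (measurableTypeR R * 'rV[R]_d)%type.
Local Notation normc := Normc.normc.
Local Notation coef := (int -> 'rV[int]_d -> R[i]).

Definition synth (phi : pt -> R[i]) (c : coef) : pt -> R[i] := fun z =>
  csum (fun k1 : int => csum (fun k2 : 'rV[int]_d =>
    c k1 k2 * phi (z.1 - k1%:~R, z.2 - map_mx intr k2))).

Definition supp_in (L : nat) (phi : pt -> R[i]) : Prop := forall z : pt,
  L%:R < `|z.1| \/ (exists i, L%:R < `|z.2 ord0 i|) -> phi z = 0.

Variables (phi : pt -> R[i]) (L : nat).
Hypothesis phiL : supp_in L phi.
Local Notation n := L.+2.
Local Notation box := ('I_(n.*2.+1) * 'rV['I_(n.*2.+1)]_d)%type.
Implicit Types (c : coef) (j : box).

(** Tolerance 2, so that the cell of a point also serves all points at distance at most 1 from it.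
    This is why the boxes of shifts have radius [L.+2] for a support of radius [L]. *)
Definition near_cell (z : pt) (a : int) (b : 'rV[int]_d) : Prop :=
  `|z.1 - a%:~R| <= 2 /\ forall i, `|z.2 ord0 i - (b ord0 i)%:~R| <= 2.

Let far (x : R) (a k : int) : `|x - a%:~R| <= 2 -> n%:Z < `|a - k| ->
  L%:R < `|x - k%:~R|.
Proof.
move=> xa nk.
have nk' : (n%:R : R) < `|a%:~R - k%:~R|.
  by rewrite -intrB -intr_norm -[n%:R]/(n%:Z%:~R) ltr_int.
have : `|a%:~R - k%:~R| <= `|a%:~R - x| + `|x - k%:~R| by exact: ler_distD.
rewrite (distrC _ x); move: nk'; rewrite -addn2 natrD; lra.
Qed.

Lemma synth_box c z a b : near_cell z a b -> synth phi c z =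
  \sum_(j : box) c (a - int_of_box j.1) (b - rV_of_box j.2) *
    phi (z.1 - (a - int_of_box j.1)%:~R, z.2 - map_mx intr (b - rV_of_box j.2)).
Proof.
move=> [za zb]; rewrite /synth (csum_int_box (n := n) (a := a)); last first.
  move=> k nk; rewrite (csum_seq (s := [::])) ?big_nil// => k2 _.
  by rewrite phiL ?mulr0//; left => /=; exact: far nk.
rewrite -(pair_bigA _ (fun (j1 : 'I_(n.*2.+1)) (j2 : 'rV['I_(n.*2.+1)]_d) =>
  c (a - int_of_box j1) (b - rV_of_box j2) *
  phi (z.1 - (a - int_of_box j1)%:~R, z.2 - map_mx intr (b - rV_of_box j2)))) /=.
apply: eq_bigr => j1 _; rewrite (csum_rV_box (n := n) (a := b))// => k i nk.
rewrite phiL ?mulr0//; right; exists i => /=; rewrite !mxE.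
exact: far nk.
Qed.

Lemma near_cell_floor (z w : pt) : `|z.1 - w.1| <= 1 ->
  (forall i, `|z.2 ord0 i - w.2 ord0 i| <= 1) ->
  near_cell w (Num.floor z.1) (rV_floor z.2).
Proof.
have H (x y : R) : `|x - y| <= 1 -> `|y - (Num.floor x)%:~R| <= 2.
  move=> xy; have := floor_itv x; rewrite intrD1 => /andP[f1 f2].
  move: xy; rewrite !ler_norml => /andP[? ?]; apply/andP; split; lra.
by move=> z1 z2; split => [|i]; rewrite ?mxE; exact: H.
Qed.

Lemma csum_fin_synth c (z : pt) k1 :
  exists s : seq 'rV[int]_d, forall k2, k2 \notin s ->
    c k1 k2 * phi (z.1 - k1%:~R, z.2 - map_mx intr k2) = 0.
Proof.
exists [seq rV_floor z.2 - rV_of_box j | j : 'rV['I_(n.*2.+1)]_d] => k2 nk2.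
apply: contrapT => nz; case/negP: nk2; apply/mapP.
have [|j jk] := @rV_of_box_surj n d (rV_floor z.2 - k2); last first.
  by exists j; rewrite ?mem_enum// jk opprB addrC subrK.
move=> i; rewrite leNgt; apply/negP => nk; apply: nz.
rewrite phiL ?mulr0//; right; exists i => /=; rewrite !mxE.
have [_ zb] : near_cell z (Num.floor z.1) (rV_floor z.2).
  by apply: near_cell_floor => [|j]; rewrite subrr normr0.
by move: nk; rewrite !mxE; apply: far; have := zb i; rewrite mxE.
Qed.

Lemma cmeasurable_synth c : cmeasurable phi -> cmeasurable (synth phi c).
Proof.
move=> mphi; apply: cmeasurable_csum => [k1|z].
  apply: cmeasurable_csum => [k2|z]; last exact: csum_fin_synth.
  apply: cmeasurableZ.
  exact: (cmeasurable_comp (measurable_translation (k1%:~R, map_mx intr k2)) mphi).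
exists [seq Num.floor z.1 - int_of_box j | j : 'I_(n.*2.+1)] => k1 nk1.
rewrite (csum_seq (s := [::])) ?big_nil// => k2 _.
apply: contrapT => nz; case/negP: nk1; apply/mapP.
have [|j jk] := @int_of_box_surj n (Num.floor z.1 - k1); last first.
  by exists j; rewrite ?mem_enum// jk opprB addrC subrK.
rewrite leNgt; apply/negP => nk; apply: nz.
rewrite phiL ?mulr0//; left => /=; apply: far nk.
have [] // : near_cell z (Num.floor z.1) (rV_floor z.2).
by apply: near_cell_floor => [|j]; rewrite subrr normr0.
Qed.

(** Linearity is read off the common finite form [synth_box], where no question of summability
    arises. *)
Lemma synthB c c' : synth phi (c - c') = synth phi c - synth phi c'.
Proof.
apply/funext => z.
have zn : near_cell z (Num.floor z.1) (rV_floor z.2).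
  by apply: near_cell_floor => [|j]; rewrite subrr normr0.
have -> : (synth phi c - synth phi c') z = synth phi c z - synth phi c' z by [].
rewrite !(synth_box _ zn) -sumrB; apply: eq_bigr => j _.
by rewrite -mulrBl.
Qed.

Lemma synthZ (a : R[i]) c :
  synth phi (fun k1 k2 => a * c k1 k2) = fun z => a * synth phi c z.
Proof.
apply/funext => z.
have zn : near_cell z (Num.floor z.1) (rV_floor z.2).
  by apply: near_cell_floor => [|j]; rewrite subrr normr0.
by rewrite !(synth_box _ zn) mulr_sumr; apply: eq_bigr => j _; rewrite mulrA.
Qed.

(** Total modulus of the coefficients that can act near the cell of [z]. Being a finite sum of
    integer shifts of the step function of |c|, it inherits the norm bound of [c]. *)
Definition cell_sum c (z : pt) : R :=
  \sum_(j : box) normc (c (Num.floor z.1 - int_of_box j.1) (rV_floor z.2 - rV_of_box j.2)).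

Lemma cell_sum_ge0 c z : 0 <= cell_sum c z.
Proof. by apply: sumr_ge0 => j _; exact: normc_ge0. Qed.

Lemma synth_osc_le c (e : R) (z w : pt) : `|z.1 - w.1| <= 1 ->
  (forall i, `|z.2 ord0 i - w.2 ord0 i| <= 1) ->
  (forall a1 a2, normc (phi (z.1 - a1, z.2 - a2) - phi (w.1 - a1, w.2 - a2)) <= e) ->
  normc (synth phi c z - synth phi c w) <= e * cell_sum c z.
Proof.
move=> zw1 zw2 osc.
have zn : near_cell z (Num.floor z.1) (rV_floor z.2).
  by apply: near_cell_floor => [|j]; rewrite subrr normr0.
rewrite (synth_box c zn) (synth_box c (near_cell_floor zw1 zw2)) -sumrB.
apply: le_trans (normc_sum _ _) _; rewrite mulr_sumr; apply: ler_sum => j _.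
by rewrite -mulrBr Normc.normcM mulrC ler_wpM2r ?normc_ge0.
Qed.

Lemma synth_le c (B : R) (z : pt) : (forall w, normc (phi w) <= B) ->
  normc (synth phi c z) <= B * cell_sum c z.
Proof.
move=> phiB.
have zn : near_cell z (Num.floor z.1) (rV_floor z.2).
  by apply: near_cell_floor => [|j]; rewrite subrr normr0.
rewrite (synth_box c zn).
apply: le_trans (normc_sum _ _) _; rewrite mulr_sumr; apply: ler_sum => j _.
by rewrite Normc.normcM mulrC ler_wpM2r ?normc_ge0.
Qed.

End synthesis.

(** * Continuous generators with compact support *)

Section compact_support.
Context {R : realType} {d : nat}.
Local Notation pt := (R * 'rV[R]_d)%type.
Local Notation normc := Normc.normc.
Variable phi : pt -> R[i].
Hypothesis cphi : continuous (phi : pt -> R[i]^o).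
Hypothesis Kphi : compact (supp phi).

Let phi_out z : ~ supp phi z -> phi z = 0.
Proof. by move=> nz; apply: contrapT => pz; apply: nz; exact: subset_closure. Qed.

Lemma continuous_normc z (e : R) : 0 < e ->
  \forall w \near z, normc (phi z - phi w) < e.
Proof.
move=> e0; have /cvgrPdist_lt /(_ e%:C%C) := @cphi z.
rewrite ltcR => /(_ e0); apply: filterS => w.
by rewrite normc_def ltcR; case: (phi z - phi w).
Qed.

Lemma ball_ptP (z w : pt) (e : R) : 0 < e -> ball z e w <->
  `|z.1 - w.1| < e /\ forall i, `|z.2 ord0 i - w.2 ord0 i| < e.
Proof.
move=> e0; split=> [[b1 [_ b2]]|[b1 b2]]; split => //.
  by move=> i; exact: (b2 ord0 i).
by split => // i j; rewrite ord1; exact: b2.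
Qed.

(** Heine-Cantor on the support; off the support both values vanish unless the other point lies in
    it, a symmetric case. The bound [g <= 1] makes [synth_osc_le] applicable. *)
Lemma uniformly_continuous_supp (e : R) : 0 < e -> exists2 g : R, 0 < g <= 1 &
  forall z w : pt, `|z.1 - w.1| < g -> (forall i, `|z.2 ord0 i - w.2 ord0 i| < g) ->
  normc (phi z - phi w) <= e.
Proof.
move=> e0.
have : \forall g \near 0^'+, forall z, supp phi z ->
    forall w, ball z g w -> normc (phi z - phi w) <= e.
  apply: ((compact_near_coveringP _).1 Kphi) => x _.
  have e20 : 0 < e / 2 by rewrite divr_gt0.
  have /nbhs_ballP[r /= r0 xr] := continuous_normc x e20.
  have r20 : 0 < r / 2 by rewrite divr_gt0.
  exists (ball x (r / 2), [set g | g < r / 2]) => /=.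
    split; first exact: nbhsx_ballx.
    exact: nbhs_right_lt.
  move=> [z g] /= [xz gr] w zw.
  have xw : ball x r w.
    by rewrite [r]splitr; apply: (ball_triangle xz); apply: le_ball zw; exact: ltW.
  have xz' : ball x r z by apply: le_ball xz; rewrite ler_pdivrMr// ler_pMr// ler1n.
  have := xr _ xw; have := xr _ xz' => /= h1 h2.
  rewrite (_ : phi z - phi w = (phi z - phi x) + (phi x - phi w)); last first.
    by rewrite addrA subrK.
  apply: le_trans (normc_triangle _ _) _.
  by rewrite (normc_distC (phi z)) [e]splitr lerD// ltW.
move=> ev.
have /filter_ex[g [[g0 g1] H]] : \forall g \near 0^'+,
    (0 < g /\ g <= 1) /\ forall z, supp phi z -> forall w, ball z g w -> normc (phi z - phi w) <= e.
  apply: filterI => //; apply: filterI; first exact: nbhs_right_gt.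
  exact: nbhs_right_le.
exists g; first by rewrite g0.
move=> z w z1 z2.
have zw : ball z g w by apply/ball_ptP.
have [Kz|nKz] := pselect (supp phi z); first exact: H.
have [Kw|nKw] := pselect (supp phi w).
  by rewrite normc_distC; apply: H => //; exact: ball_sym.
by rewrite !phi_out// subrr Normc.normc0 ltW.
Qed.

Lemma supp_bounded : exists L, supp_in L phi.
Proof.
have : \forall M \near +oo, forall z, supp phi z ->
    `|z.1| <= M /\ forall i, `|z.2 ord0 i| <= M.
  apply: ((compact_near_coveringP _).1 Kphi) => x _.
  have [N [N1 N2]] : exists N : R, `|x.1| <= N /\ forall i, `|x.2 ord0 i| <= N.
    exists (`|x.1| + \sum_i `|x.2 ord0 i|); split.
      by rewrite lerDl; apply: sumr_ge0.
    move=> i; rewrite (bigD1 i)//= addrCA lerDl addr_ge0//.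
    by apply: sumr_ge0.
  exists (ball x 1, [set M | N + 1 < M]) => /=.
    split; first exact: nbhsx_ballx.
    by apply: nbhs_pinfty_gt; exact: num_real.
  move=> [z M] /= [/(ball_ptP _ _ ltr01)[xz1 xz2] NM].
  have tri (a b : R) : `|a| <= N -> `|a - b| < 1 -> `|b| <= M.
    move=> aN ab; have : `|b| <= `|a| + `|a - b|.
      by rewrite -{1}(subrK a b) addrC (le_trans (ler_normD _ _))// distrC.
    lra.
  by split => [|i]; [exact: tri xz1|exact: tri (xz2 i)].
move=> [M [_ HM]].
exists (Num.bound M) => z nz; apply: phi_out => Kz.
have [|z1 z2] := HM (Num.bound M)%:R _ z Kz.
  exact: unstable.ltr_bound.
by case: nz => [|[j]]; rewrite ltNge ?z1 ?z2.
Qed.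

Lemma bounded_supp : exists2 B : R, 0 < B & forall z, normc (phi z) <= B.
Proof.
have : \forall M \near +oo, forall z, supp phi z -> normc (phi z) <= M.
  apply: ((compact_near_coveringP _).1 Kphi) => x _.
  have /nbhs_ballP[r /= r0 xr] := continuous_normc x ltr01.
  exists (ball x r, [set M | normc (phi x) + 1 < M]) => /=.
    split; first exact: nbhsx_ballx.
    by apply: nbhs_pinfty_gt; exact: num_real.
  move=> [z M] /= [xz NM]; have := xr _ xz => /= h.
  rewrite -(subrK (phi x) (phi z)); apply: le_trans (normc_triangle _ _) _.
  by rewrite normc_distC; lra.
move=> [M [_ HM]].
pose B := Num.max (M + 1) 1.
exists B; first by rewrite lt_max ltr01 orbT.
move=> z; have [Kz|nKz] := pselect (supp phi z).
  by apply: HM => //; rewrite lt_max ltrDl ltr01.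
by rewrite phi_out// Normc.normc0 le_max ler01 orbT.
Qed.

End compact_support.

(** * Norm bounds for synthesis *)

Section synthesis_bounds.
Context {R : realType} {d : nat} (p q : R).
Hypotheses (p1 : 1 <= p) (q1 : 1 <= q).
Local Notation pt := (R * 'rV[R]_d)%type.
Local Notation mpt := (measurableTypeR R * 'rV[R]_d)%type.
Local Notation normc := Normc.normc.
Local Notation Lpq_bound := (@Lpq_bound R d p q).
Local Notation coef := (int -> 'rV[int]_d -> R[i]).

Lemma Lpq_bound_sum n : exists2 A : R, 0 < A &
  forall (I : Type) (s : seq I) (F : I -> pt -> R[i]) r, size s = n -> 0 <= r ->
  (forall i, Lpq_bound (F i) r) -> Lpq_bound (fun z => \sum_(i <- s) F i z) (A * r).
Proof.
elim: n => [|n [A A0 IH]].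
  exists 1 => // I s F r /size0nil -> r0 _.
  under eq_fun do rewrite big_nil.
  by apply: (Lpq_bound_le p1 _ (Lpq_bound0 p1 q1)); rewrite mul1r.
exists (8 * (1 + A)); first by rewrite mulr_gt0 ?addr_gt0.
move=> I [//|i s] F r [sn] r0 bF.
under eq_fun do rewrite big_cons.
apply: (Lpq_bound_le p1 _ (Lpq_boundD p1 q1 (bF i) (IH _ s F r sn r0 bF))).
suff -> : 8 * (r + A * r) = 8 * (1 + A) * r by [].
by ring.
Qed.

Lemma cell_sum_bound L : exists2 A : R, 0 < A & forall (c : coef) r,
  Lpq_bound (cstep c) r -> Lpq_bound (fun z => (cell_sum L c z)%:C%C) (A * r).
Proof.
set n := size (index_enum ('I_(L.+2.*2.+1) * 'rV['I_(L.+2.*2.+1)]_d)%type).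
have [A A0 HA] := Lpq_bound_sum n; exists A; [exact: A0|move=> c r bc].
rewrite (_ : (fun z => _) = fun z =>
  \sum_(j : 'I_(L.+2.*2.+1) * 'rV['I_(L.+2.*2.+1)]_d)
    (normc (cstep (fun k1 k2 => c (k1 - int_of_box j.1) (k2 - rV_of_box j.2)) z))%:C%C).
  apply: HA => //; first exact: Lpq_bound_ge0 bc.
  move=> j; have bj := Lpq_bound_shift (int_of_box j.1) (rV_of_box j.2) bc.
  apply: (Lpq_bound_dom p1 q1 _ _ bj).
    by apply: cmeasurable_real; apply: measurable_normc; exact: cmeasurable_cstep.
  by move=> z; rewrite normc_real ger0_norm ?normc_ge0.
by apply/funext => z; rewrite rmorph_sum.
Qed.

Variable phi : pt -> R[i].
Hypothesis cphi : continuous (phi : pt -> R[i]^o).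
Hypothesis Kphi : compact (supp phi).
Hypothesis mphi : cmeasurable phi.

Lemma synth_bound : exists2 B : R, 0 < B & forall (c : coef) r,
  Lpq_bound (cstep c) r -> Lpq_bound (synth phi c) (B * r).
Proof.
have [L phiL] := supp_bounded Kphi.
have [M M0 phiM] := bounded_supp cphi Kphi.
have [A A0 HA] := cell_sum_bound L.
exists (M * A); first exact: mulr_gt0.
move=> c r /HA bc; rewrite -mulrA.
have := Lpq_boundZ q1 (M%:C)%C bc; rewrite normc_real (ger0_norm (ltW M0)) => b.
apply: (Lpq_bound_dom p1 q1 _ _ b); first exact: cmeasurable_synth phiL _ mphi.
move=> z; rewrite Normc.normcM !normc_real.
rewrite (ger0_norm (ltW M0)) (ger0_norm (cell_sum_ge0 _ _ _)).
exact: synth_le.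
Qed.

(** A nonzero value of modulus [a] at [z0] would keep the modulus above [a / 2] on a whole cube, and
    [Lpq_bound_box] would bound the norm away from 0. *)
Lemma synth_eq0 (c : coef) : (forall e, 0 < e -> Lpq_bound (synth phi c) e) ->
  synth phi c = 0.
Proof.
move=> small; apply/funext => z0; apply: contrapT => nz.
have [L phiL] := supp_bounded Kphi.
pose a := normc (synth phi c z0).
have a0 : 0 < a.
  by rewrite lt_def normc_ge0 andbT; apply/eqP => /Normc.eq0_normc.
(* The summand 1 allows division by [S]; an oscillation of [phi] below [a / 2 / S] makes the
   synthesis vary by at most [a / 2]. *)
pose S := cell_sum L c z0 + 1.
have S0 : 0 < S by rewrite ltr_wpDl ?cell_sum_ge0.
have e0 : 0 < a / 2 / S by rewrite !divr_gt0.
have [g /andP[g0 g1] osc] := uniformly_continuous_supp cphi Kphi e0.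
have half_lt : g / 2 < g by rewrite ltr_pdivrMr// ltr_pMr// ltr1n.
have near_le (x y : R) : x <= y < x + g / 2 -> `|x - y| < g.
  by move=> /andP[? ?]; rewrite ltr_norml; apply/andP; split; lra.
have box_le (w : mpt) : z0.1 <= w.1 < z0.1 + g / 2 -> rV_box z0.2 (g / 2) w.2 ->
    a / 2 <= normc (synth phi c w).
  move=> /near_le w1 w2.
  have {}w2 i : `|z0.2 ord0 i - w.2 ord0 i| < g by apply: near_le; exact: w2.
  have : normc (synth phi c z0 - synth phi c w) <= a / 2.
    apply: (@le_trans _ _ (a / 2 / S * cell_sum L c z0)).
      apply: (synth_osc_le phiL).
      - by apply: ltW; exact: lt_le_trans w1 g1.
      - by move=> i; apply: ltW; exact: lt_le_trans (w2 i) g1.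
      move=> a1 a2; apply: osc => /= [|i].
        by rewrite opprB addrA subrK.
      by rewrite !mxE opprB addrA subrK.
    by rewrite -mulrA ler_piMr ?divr_ge0 ?ltW// mulrC ltr_pdivrMr// mul1r ltrDl.
  have : a <= normc (synth phi c z0 - synth phi c w) + normc (synth phi c w).
    by rewrite /a -{1}(subrK (synth phi c w) (synth phi c z0)) normc_triangle.
  lra.
have p0 : 0 < p by exact: lt_le_trans p1.
pose V := (a / 2) `^ p * (g / 2 * ((g / 2) ^+ d) `^ (p / q)).
have V0 : 0 < V.
  by rewrite !mulr_gt0 ?powR_gt0 ?exprn_gt0 ?divr_gt0.
have H e : 0 < e -> V <= e `^ p.
  move=> e_gt0; apply: (Lpq_bound_box p1 q1 _ _ box_le (small e e_gt0)).
    by rewrite divr_ge0 ?ltW.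
  by rewrite divr_ge0 ?ltW.
(* This choice of [e] gives [V <= V / 2], contradicting [V > 0]. *)
have := H ((V / 2) `^ p^-1); rewrite powR_gt0 ?divr_gt0// => /(_ isT).
rewrite -powRrM mulVf ?gt_eqF// powRr1 ?divr_ge0 ?(ltW V0)//.
by rewrite ler_pdivlMr// ger_pMr// leNgt ltr1n.
Qed.

End synthesis_bounds.

(** * The range of the projection *)

Section projection.
Context {R : realType} {d : nat} (p q : R).
Hypotheses (p1 : 1 <= p) (q1 : 1 <= q).
Local Notation pt := (R * 'rV[R]_d)%type.
Local Notation normc := Normc.normc.
Local Notation Lpq_bound := (@Lpq_bound R d p q).
Local Notation coef := (int -> 'rV[int]_d -> R[i]).

Variable phi : pt -> R[i].
Hypothesis cphi : continuous (phi : pt -> R[i]^o).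
Hypothesis Kphi : compact (supp phi).
Hypothesis mphi : cmeasurable phi.

Lemma VpqP g : Vpq p q phi g <->
  exists2 c : coef, (exists r, Lpq_bound (cstep c) r) & g = synth phi c.
Proof.
split=> [[c /(lpqP q p1) fc gc]|[c /(lpqP q p1) fc ->]].
  by exists c => //; apply/funext.
by exists c.
Qed.

Lemma Vpq_Lpq g : Vpq p q phi g -> Lpq p q g.
Proof.
move=> /VpqP[c [r bc] ->]; have [B B0 HB] := synth_bound p1 q1 cphi Kphi mphi.
by apply/(LpqP q p1); exists (B * r); exact: HB.
Qed.

Lemma VpqB g h : Vpq p q phi g -> Vpq p q phi h -> Vpq p q phi (fun z => g z - h z).
Proof.
move=> /VpqP[c [r bc] ->] /VpqP[c' [r' bc'] ->].
have [L phiL] := supp_bounded Kphi.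
apply/VpqP; exists (c - c'); last by rewrite (synthB phiL).
by exists (8 * (r + r')); exact: (Lpq_boundB p1 q1 bc bc').
Qed.

Lemma Vpq0 : Vpq p q phi (fun=> 0).
Proof.
have [L phiL] := supp_bounded Kphi.
apply/VpqP; exists (0 : coef); first by exists 0; exact: (Lpq_bound0 p1 q1).
by have := synthB phiL 0 0; rewrite !subrr => ->.
Qed.

Lemma VpqD g h : Vpq p q phi g -> Vpq p q phi h -> Vpq p q phi (fun z => g z + h z).
Proof.
move=> Vg Vh; have := VpqB Vg (VpqB Vpq0 Vh).
by under eq_fun do rewrite sub0r opprK.
Qed.

Lemma cae_eq_bound0 (f g : pt -> R[i]) : cmeasurable f -> cmeasurable g ->
  cae_eq f g -> Lpq_bound (fun z => f z - g z) 0.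
Proof.
move=> mf mg fg; have -> : 0 = 8 * 0 :> R by rewrite mulr0.
apply: (Lpq_bound_ae p1 q1 _ _ (Lpq_bound0 p1 q1)); first exact: cmeasurableB.
apply: lebesgue_prod_aeS fg.
by move=> z /= ->; rewrite subrr.
Qed.

Variable P : (pt -> R[i]) -> pt -> R[i].
Hypothesis hP : bounded_projection p q phi P.

Lemma projection_bound : exists2 B : R, 1 <= B & forall f r,
  Lpq_bound f r -> Lpq_bound (P f) (B * r).
Proof.
have [PL _ [C HC] _ _] := hP.
exists (Num.max C 1); first by rewrite le_max lexx orbT.
move=> f r bf; have r0 := Lpq_bound_ge0 bf.
have Lf : Lpq p q f by apply/(LpqP q p1); exists r.
have [mPf _] := PL f Lf.
have B0 : 0 <= Num.max C 1 by rewrite le_max ler01 orbT.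
apply: (Lpq_boundE p1 mPf); first exact: mulr_ge0.
apply: (le_trans (HC f Lf)); rewrite EFinM.
apply: (@le_trans _ _ ((Num.max C 1)%:E * Lpq_norm p q f)%E).
  by rewrite lee_wpmul2r ?poweR_ge0// lee_fin le_max lexx.
by rewrite lee_wpmul2l ?lee_fin//; exact: Lpq_bound_norm.
Qed.

Lemma projectionB f g : Lpq p q f -> Lpq p q g ->
  cae_eq (P (fun z => f z - g z)) (fun z => P f z - P g z).
Proof.
move=> Lf Lg; have [_ lin _ _ _] := hP.
have := lin (-1) g f Lg Lf.
under eq_fun do rewrite mulN1r addrC.
move=> H; apply: lebesgue_prod_aeS H.
by move=> z /= ->; rewrite mulN1r addrC.
Qed.

Let P_measurable f : Lpq p q f -> cmeasurable (P f).
Proof. by have [PL _ _ _ _] := hP; move=> /PL[]. Qed.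

Lemma projectionB_bound f g r : Lpq p q f -> Lpq p q g ->
  Lpq_bound (P (fun z => f z - g z)) r -> Lpq_bound (fun z => P f z - P g z) (8 * r).
Proof.
move=> Lf Lg; apply: (Lpq_bound_ae p1 q1); last exact: projectionB.
by apply: cmeasurableB; exact: P_measurable.
Qed.

(** With [g = P h] almost everywhere, the chain is [P g], [P (P h)], [P h], [g]. Its first link uses
    that boundedness makes [P] respect equality almost everywhere. *)
Lemma projection_fix g : Vpq p q phi g -> Lpq_bound (fun z => P g z - g z) 0.
Proof.
move=> Vg; have Lg := Vpq_Lpq Vg; have [PL _ _ PP [_ onto]] := hP.
have [h Lh hg] := onto g Vg; have Lph := PL h Lh.
have [B _ HB] := projection_bound.
have b1 : Lpq_bound (fun z => P g z - P (P h) z) 0.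
  have -> : 0 = 8 * (B * 0) :> R by rewrite !mulr0.
  apply: projectionB_bound => //; apply: HB.
  have := Lpq_boundN p1 q1 (cae_eq_bound0 (P_measurable Lh) Lg.1 hg).
  by under eq_fun do rewrite opprB.
have b2 : Lpq_bound (fun z => P (P h) z - P h z) 0.
  by apply: cae_eq_bound0; [exact: P_measurable|exact: P_measurable|exact: PP].
have b3 := cae_eq_bound0 (P_measurable Lh) Lg.1 hg.
have := Lpq_boundD p1 q1 b1 (Lpq_boundD p1 q1 b2 b3).
rewrite !(addr0, mulr0).
by under eq_fun do rewrite !subrKA.
Qed.

(** The sum [v] of the series exists in L^{p,q} but need not be a synthesis; [P v] is one up to a
    null set, and since [P] fixes the partial sums [W], the difference is [P (v - W)] up to norm
    0. *)
Lemma synth_range_complete : exists2 C : R, 16 <= C &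
  forall (e : nat -> coef) (r : nat -> R),
  (forall k, exists s, Lpq_bound (cstep (e k)) s) ->
  (forall k, r k.+1 <= 16^-1 * r k) -> (forall k, Lpq_bound (synth phi (e k)) (r k)) ->
  exists2 s, (exists t, Lpq_bound (cstep s) t) &
    forall n, Lpq_bound (synth phi s - synth phi (\sum_(k < n) e k)) (C * r n).
Proof.
have [B B1 HB] := projection_bound; have [L phiL] := supp_bounded Kphi.
(* 16 bounds the tail [v - W], [B] comes from [P], and the three factors 8 from splitting
   [P (v - W)], replacing [P W] by [W], and replacing [P v] by [g]. *)
exists (8 * (8 * (8 * (B * 16)))); first by lra.
move=> e r fe rr be; have bv := Lpq_complete p1 q1 rr be.
set v := (fun z : pt => clim (fun m => \sum_(k < m) synth phi (e k) z)) in bv.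
have Lv : Lpq p q v.
  apply/(LpqP q p1); exists (16 * r 0%N); have := bv 0%N.
  by under eq_fun do rewrite big_ord0 subr0.
have [PL _ _ _ [into _]] := hP.
have [g Vg Pvg] := into v Lv; have [s fs gs] := (VpqP g).1 Vg.
exists s => // n; rewrite -gs.
have [Wfin WE] : (exists t, Lpq_bound (cstep (\sum_(k < n) e k)) t) /\
    forall z, synth phi (\sum_(k < n) e k) z = \sum_(k < n) synth phi (e k) z.
  elim: n => [|n [[t IH1] IH2]].
    split; first by rewrite big_ord0; exists 0; exact: (Lpq_bound0 p1 q1).
    move=> z; rewrite !big_ord0.
    by have := synthB phiL 0 0; rewrite !subrr => ->.
  have [t' be'] := fe n.
  split.
    by rewrite big_ord_recr; exists (8 * (t + t')); exact: (Lpq_boundD p1 q1 IH1 be').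
  move=> z; rewrite !big_ord_recr /= -IH2.
  rewrite -[X in _ + X](opprK (e n)) (synthB phiL).
  rewrite -(sub0r (e n)) (synthB phiL).
  have -> : synth phi 0 = 0 by have := synthB phiL 0 0; rewrite !subrr.
  by rewrite sub0r opprK.
set W := synth phi (\sum_(k < n) e k) in WE *.
have VW : Vpq p q phi W by apply/VpqP; exists (\sum_(k < n) e k).
have bvW : Lpq_bound (fun z => v z - W z) (16 * r n).
  by under eq_fun do rewrite WE; exact: bv.
have b1 := Lpq_boundN p1 q1 (cae_eq_bound0 (P_measurable Lv) (Vpq_Lpq Vg).1 Pvg).
have b2 := projectionB_bound Lv (Vpq_Lpq VW) (HB _ _ bvW).
have b3 := Lpq_boundD p1 q1 b2 (projection_fix VW).
have := Lpq_boundD p1 q1 b1 b3; rewrite addr0 add0r.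
rewrite (_ : (fun z => _) = g - W).
  by congr Lpq_bound; ring.
apply/funext => z; by rewrite /= opprB !subrKA.
Qed.

Lemma bounded_representation : exists2 C : R, 0 < C & forall g r, 0 < r ->
  Vpq p q phi g -> Lpq_bound g r ->
  exists2 c : coef, Lpq_bound (cstep c) (C * r) & g = synth phi c.
Proof.
have [L phiL] := supp_bounded Kphi.
have [C C16 HC] := synth_range_complete.
have normcR (a : R) : 0 < a -> normc (a%:C)%C = a.
  by move=> a0; rewrite normc_real gtr0_norm.
pose bE (c : coef) r := Lpq_bound (cstep c) r.
pose sE (a : R) (c : coef) : coef := fun k1 k2 => (a%:C)%C * c k1 k2.
pose sF (a : R) (v : pt -> R[i]) : pt -> R[i] := fun z => (a%:C)%C * v z.
have C0 : 0 < C by lra.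
have rho01 : 0 < (16^-1 : R) < 1 by apply/andP; split; lra.
have bE_le c (r s : R) : r <= s -> bE c r -> bE c s by exact: Lpq_bound_le.
have bF_le (v : pt -> R[i]) (r s : R) : r <= s -> Lpq_bound v r -> Lpq_bound v s.
  exact: Lpq_bound_le.
have bEB c c' r s : bE c r -> bE c' s -> bE (c - c') (8 * (r + s)).
  exact: Lpq_boundB.
have bEZ (a : R) c r : 0 < a -> bE c r -> bE (sE a c) (a * r).
  by move=> a0 bc; rewrite -[X in X * r](normcR a a0); exact: Lpq_boundZ.
have bFZ (a : R) v r : 0 < a -> Lpq_bound v r -> Lpq_bound (sF a v) (a * r).
  by move=> a0 bc; rewrite -[X in X * r](normcR a a0); exact: Lpq_boundZ.
have sFB (a : R) (u v : pt -> R[i]) : sF a (u - v) = sF a u - sF a v.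
  by apply/funext => z; rewrite /sF /= mulrBr.
have sFK (a : R) (v : pt -> R[i]) : 0 < a -> sF a (sF a^-1 v) = v.
  move=> a0; apply/funext => z; rewrite /sF mulrA -rmorphM /= mulfV ?gt_eqF//.
  by rewrite mul1r.
have complE (e : nat -> coef) (r : R) : 0 < r ->
    (forall k, bE (e k) (r * 16^-1 ^+ k)) ->
    exists s, forall n, bE (s - \sum_(k < n) e k) (C * (r * 16^-1 ^+ n)).
  move=> r0 be; have [|s Hs] := lpq_complete p1 q1 (r := fun k => r * 16^-1 ^+ k) _ be.
    by move=> k; rewrite exprS mulrCA.
  exists s => n; apply: bE_le (Hs n); rewrite ler_wpM2r//.
  by rewrite mulr_ge0 ?exprn_ge0 ?invr_ge0// ltW.
have complF (e : nat -> coef) (r : nat -> R) :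
    (forall k, exists s, bE (e k) s) -> (forall k, 0 < r k) ->
    (forall k, r k.+1 <= 16^-1 * r k) -> (forall k, Lpq_bound (synth phi (e k)) (r k)) ->
    exists2 s, (exists t, bE s t) &
      forall n, Lpq_bound (synth phi s - synth phi (\sum_(k < n) e k)) (C * r n).
  by move=> fe _; exact: HC.
(* The quasi-triangle constant is [K = 8], and [rho] is 1/16. *)
have [B B0 HB] := open_mapping (ltr0Sn R 7) C0 rho01
  (Lpq_bound0 p1 q1 : bE 0 0) (Lpq_bound0 p1 q1) bE_le bF_le bEB
  (fun u v r s => @Lpq_boundB _ _ _ _ p1 q1 u v r s)
  (fun u r => @Lpq_boundN _ _ _ _ p1 q1 u r) bEZ bFZ (synthB phiL)
  (fun a => synthZ phiL (a%:C)%C) sFB sFK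
  (synth_bound p1 q1 cphi Kphi mphi) complE complF.
exists B => // g r r0 /VpqP[c fc ->] bg.
have [c' bc' small] := HB c r r0 fc bg.
exists c' => //; apply/eqP; rewrite -subr_eq0 -(synthB phiL); apply/eqP.
apply: (synth_eq0 p1 q1 cphi Kphi) => e e0; rewrite (synthB phiL).
exact: small.
Qed.

End projection.

(** * Quasi-interpolation and reconstruction *)

Section quasi_interpolation.
Context {R : realType} {d : nat}.
Local Notation pt := (R * 'rV[R]_d)%type.
Local Notation normc := Normc.normc.

Lemma enorm_ge1 (z : pt) : `|z.1| <= enorm z.
Proof.
rewrite /enorm /dotp -expr2 -sqrtr_sqr ler_wsqrtr// lerDl.
by apply: sumr_ge0 => i _; rewrite -expr2 sqr_ge0.
Qed.

Lemma enorm_ge2 (z : pt) i : `|z.2 ord0 i| <= enorm z.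
Proof.
rewrite /enorm /dotp -expr2 -sqrtr_sqr ler_wsqrtr// (bigD1 i)//= -expr2 addrCA lerDl.
by rewrite addr_ge0 ?sqr_ge0// sumr_ge0// => j _; rewrite -expr2 sqr_ge0.
Qed.

Lemma enorm_lt (z : pt) (r delta : R) : 0 < delta -> `|z.1| <= r ->
  (forall i, `|z.2 ord0 i| <= r) -> d.+1%:R * r ^+ 2 < delta ^+ 2 -> enorm z < delta.
Proof.
move=> delta0 z1 z2 rd; rewrite -(ger0_norm (ltW delta0)) -sqrtr_sqr /enorm.
rewrite ltr_sqrt ?exprn_gt0//; apply: le_lt_trans rd.
have sq t : `|t| <= r -> t * t <= r ^+ 2.
  move=> tr; rewrite -expr2 -real_normK ?num_real// ler_sqr ?nnegrE//.
  exact: le_trans tr.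
rewrite /dotp mulrSr mulrDl mul1r addrC lerD ?sq//.
apply: (@le_trans _ _ (\sum_(i < d) r ^+ 2)); first by apply: ler_sum => i _; exact: sq.
by rewrite sumr_const card_ord -mulr_natl.
Qed.

Context {J : countType} (x : J -> R) (y : J -> 'rV[R]_d).

(** Each cell of a sufficiently fine grid contains at most one sample, so integer cell labels
    distinguish the samples. This gives local finiteness in [bupu_finite]. *)
Lemma separated_injection : strongly_separated x y ->
  exists2 N : R, 0 < N & injective (fun jk : J * J =>
    (Num.floor (N * x jk.1), rV_floor (N *: y jk.2))).
Proof.
move=> sep.
have [delta delta0 Hdelta] : exists2 delta : R, 0 < delta &
    forall jk jk' : J * J, jk <> jk' ->
      delta <= enorm ((x jk.1, y jk.2) - (x jk'.1, y jk'.2) : pt).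
  move: sep; rewrite /strongly_separated; set m := ereal_inf _.
  have Hm jk jk' : jk <> jk' ->
      (m <= (enorm ((x jk.1, y jk.2) - (x jk'.1, y jk'.2) : pt))%:E)%E.
    by move=> ne; apply: ereal_inf_lbound; exists (jk, jk').
  case: m Hm => [r Hm r0|Hm _|//].
    by exists r => // jk jk' /Hm; rewrite lee_fin.
  (* An infinite infimum means that no two index pairs are distinct, so any [delta] will do. *)
  by exists 1 => // jk jk' /Hm; rewrite leye_eq.
(* Then [d.+1 < N * delta <= (N * delta) ^+ 2], so two points of one cell of side [N^-1] are closer
   than [delta]. *)
pose N := d.+1%:R / delta + 1.
have N0 : 0 < N by rewrite addr_gt0// divr_gt0.
exists N => // jk jk' [e1 e2]; apply: contrapT => ne.
have := Hdelta _ _ ne; apply/negP; rewrite -ltNge.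
have fl (a b : R) : Num.floor (N * a) = Num.floor (N * b) -> `|a - b| <= N^-1.
  move=> ab; have := floor_itv (N * a); have := floor_itv (N * b); rewrite ab !intrD1.
  move=> /andP[? ?] /andP[? ?].
  rewrite -(ler_pM2l N0) mulfV ?gt_eqF// -{1}(gtr0_norm N0) -normrM mulrBr.
  by rewrite ler_norml; apply/andP; split; lra.
apply: (@enorm_lt _ N^-1) => //=; first exact: fl.
  move=> i; rewrite !mxE; apply: fl.
  by have := congr1 (fun w : 'rV_d => w ord0 i) e2; rewrite !mxE.
rewrite exprVn ltr_pdivrMr ?exprn_gt0// -exprMn [delta * N]mulrC.
have : d.+1%:R < N * delta by rewrite mulrDl divfK ?gt_eqF// ltrDl mul1r.
have : 1 <= d.+1%:R :> R by rewrite ler1n.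
move=> d1 dN; apply: (lt_le_trans dN); rewrite expr2 ler_peMr//; lra.
Qed.

Variables (gamma : R) (beta : J -> J -> pt -> R).
Hypothesis sep : strongly_separated x y.
Hypothesis hbeta : bupu x y gamma beta.

Lemma bupu_near j k z : beta j k z <> 0 ->
  `|z.1 - x j| < gamma /\ forall i, `|z.2 ord0 i - y k ord0 i| < gamma.
Proof.
move=> nz; have [_ _ sb _] := hbeta.
have /sb : supp (beta j k) z by apply: subset_closure.
rewrite /eball /= => zg; split; first exact: le_lt_trans (enorm_ge1 _) zg.
by move=> i; apply: le_lt_trans zg; have := enorm_ge2 (z - (x j, y k)) i; rewrite !mxE.
Qed.

(** Samples within [gamma] of [z] have labels in a finite box around the label of [z], and an
    injection pulls finite sets back to finite sets. The pairs are split into two lists because the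
    sums over [j] and [k] are iterated. *)
Lemma bupu_finite z : exists sj sk : seq J, [/\ uniq sj, uniq sk &
  forall j k, beta j k z <> 0 -> j \in sj /\ k \in sk].
Proof.
have [N N0 Ninj] := separated_injection sep.
pose pix (jk : J * J) := (Num.floor (N * x jk.1), rV_floor (N *: y jk.2)).
pose n := Num.bound (N * gamma + 1).
pose f (j : 'I_(n.*2.+1) * 'rV['I_(n.*2.+1)]_d) :=
  (Num.floor (N * z.1) - int_of_box j.1, rV_floor (N *: z.2) - rV_of_box j.2).
have fin : finite_set (pix @^-1` range f).
  apply: finite_preimage; first by move=> ? ? _ _; exact: Ninj.
  by apply: finite_image; exact: finite_finset.
have /finite_seqP[s sE] := fin.
exists (undup [seq jk.1 | jk <- s]), (undup [seq jk.2 | jk <- s]).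
split; [exact: undup_uniq|exact: undup_uniq|] => j k /bupu_near[b1 b2].
have fl (a b : R) : `|a - b| < gamma -> `|Num.floor (N * a) - Num.floor (N * b)| <= n%:Z.
  move=> ab; rewrite -(ler_int R) intr_norm intrB.
  apply: (@le_trans _ _ (N * gamma + 1)); last by apply: ltW; exact: unstable.ltr_bound.
  have := floor_itv (N * a); have := floor_itv (N * b); rewrite !intrD1.
  move=> /andP[? ?] /andP[? ?].
  have : `|N * a - N * b| < N * gamma by rewrite -mulrBr normrM (gtr0_norm N0) ltr_pM2l.
  rewrite ltr_norml ler_norml => /andP[? ?]; apply/andP; split; lra.
have /int_of_box_surj[j1 j1E] := fl _ _ b1.
have [|j2 j2E] := @rV_of_box_surj n d (rV_floor (N *: z.2) - rV_floor (N *: y k)).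
  by move=> i; rewrite !mxE; exact: fl.
have : (pix @^-1` range f) (j, k).
  exists (j1, j2) => //; rewrite /f /pix /= j1E j2E; congr (_, _).
    by rewrite opprB addrC subrK.
  by rewrite opprB addrC subrK.
rewrite sE /= => jks; rewrite !mem_undup; split.
  by apply/mapP; exists (j, k).
by apply/mapP; exists (j, k).
Qed.

Lemma quasi_interpolant_sum (f : pt -> R[i]) z (sj sk : seq J) : uniq sj -> uniq sk ->
  (forall j k, beta j k z <> 0 -> j \in sj /\ k \in sk) ->
  quasi_interpolant x y beta f z =
  \sum_(j <- sj) \sum_(k <- sk) f (x j, y k) * (beta j k z)%:C%C.
Proof.
move=> uj uk H; rewrite /quasi_interpolant (csum_seq uj) => [|j jn].
  apply: eq_bigr => j _; rewrite (csum_seq uk)// => k kn.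
  have -> : beta j k z = 0 by apply: contrapT => /H[_]; apply/negP.
  by rewrite mulr0.
rewrite (csum_seq (s := [::])) ?big_nil// => k _.
have -> : beta j k z = 0 by apply: contrapT => /H[]; rewrite (negbTE jn).
by rewrite mulr0.
Qed.

Lemma bupu_sum z (sj sk : seq J) : uniq sj -> uniq sk ->
  (forall j k, beta j k z <> 0 -> j \in sj /\ k \in sk) ->
  \sum_(j <- sj) \sum_(k <- sk) beta j k z = 1.
Proof.
move=> uj uk H; have [_ b01 _ /(_ z) b1] := hbeta.
have b0 j k : (0 <= (beta j k z)%:E)%E by rewrite lee_fin; case/andP: (b01 j k z).
apply: EFin_inj; rewrite -b1 (esum_seq uj); last 2 first.
- by move=> j; apply: esum_ge0 => k _.
- move=> j jn; rewrite esum1// => k _.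
  by have -> : beta j k z = 0 by apply: contrapT => /H[]; rewrite (negbTE jn).
rewrite -sumEFin; apply: eq_bigr => j _.
rewrite (esum_seq uk)//; last first.
  move=> k kn.
  by have -> : beta j k z = 0 by apply: contrapT => /H[_]; rewrite (negbTE kn).
by rewrite sumEFin.
Qed.

(** Writing [f z] as [f z] times the partition of unity, the error is a convex combination of
    differences [f z - f (x j, y k)] with samples near [z]. *)
Lemma quasi_interpolant_error (f : pt -> R[i]) (z : pt) (e : R) :
  (forall w : pt, `|z.1 - w.1| < gamma ->
    (forall i, `|z.2 ord0 i - w.2 ord0 i| < gamma) ->
    normc (f z - f w) <= e) ->
  normc (f z - quasi_interpolant x y beta f z) <= e.
Proof.
move=> He; have [sj [sk [uj uk H]]] := bupu_finite z.
have [_ b01 _ _] := hbeta.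
rewrite (quasi_interpolant_sum f uj uk H).
rewrite -[f z]mulr1 -[X in f z * X](rmorph1 (real_complex R)) -(bupu_sum uj uk H).
rewrite rmorph_sum mulr_sumr -sumrB.
apply: le_trans (normc_sum _ _) _.
rewrite -[e]mulr1 -(bupu_sum uj uk H) mulr_sumr; apply: ler_sum => j _.
rewrite rmorph_sum mulr_sumr -sumrB.
apply: le_trans (normc_sum _ _) _; rewrite mulr_sumr; apply: ler_sum => k _.
rewrite -mulrBl Normc.normcM normc_real.
have /andP[b0 _] := b01 j k z; rewrite ger0_norm//.
have [->|nz] := eqVneq (beta j k z) 0; first by rewrite !mulr0.
rewrite ler_wpM2r//; have [h1 h2] := bupu_near (elimN eqP nz).
exact: He.
Qed.

Lemma cmeasurable_quasi_interpolant (f : pt -> R[i]) :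
  cmeasurable (quasi_interpolant x y beta f).
Proof.
have [mb _ _ _] := hbeta.
apply: cmeasurable_csum => [j|z].
  apply: cmeasurable_csum => [k|z].
    by apply: cmeasurableZ; apply: cmeasurable_real; exact: mb.
  have [sj [sk [_ _ H]]] := bupu_finite z; exists sk => k kn.
  have -> : beta j k z = 0 by apply: contrapT => /H[_]; rewrite (negbTE kn).
  by rewrite mulr0.
have [sj [sk [_ _ H]]] := bupu_finite z; exists sj => j jn.
rewrite (csum_seq (s := [::])) ?big_nil// => k _.
have -> : beta j k z = 0 by apply: contrapT => /H[]; rewrite (negbTE jn).
by rewrite mulr0.
Qed.

End quasi_interpolation.

(** * Contraction and convergence of the iteration *)

Section reconstruction.
Context {R : realType} {d : nat} (p q : R).
Hypotheses (p1 : 1 <= p) (q1 : 1 <= q).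
Local Notation pt := (R * 'rV[R]_d)%type.
Local Notation normc := Normc.normc.
Local Notation Lpq_bound := (@Lpq_bound R d p q).

Variable phi : pt -> R[i].
Hypothesis cphi : continuous (phi : pt -> R[i]^o).
Hypothesis Kphi : compact (supp phi).
Hypothesis mphi : cmeasurable phi.
Variable P : (pt -> R[i]) -> pt -> R[i].
Hypothesis hP : bounded_projection p q phi P.

(** A value of [g] involves at most [N] coefficients, each bounded by the l^{p,q} norm of a
    controlled representation. *)
Lemma Vpq_sup_bound : exists2 C : R, 0 < C & forall g r, 0 < r ->
  Vpq p q phi g -> Lpq_bound g r -> forall z, normc (g z) <= C * r.
Proof.
have [L phiL] := supp_bounded Kphi.
have [B B0 HB] := bounded_representation p1 q1 cphi Kphi mphi hP.
have [M M0 HM] := bounded_supp cphi Kphi.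
pose N : R := #|{: 'I_(L.+2.*2.+1) * 'rV['I_(L.+2.*2.+1)]_d}|%:R.
exists (M * (N * B) + 1).
  by rewrite ltr_wpDl ?mulr_ge0// ?ler0n// ltW.
move=> g r r0 Vg bg z; have [c bc ->] := HB g r r0 Vg bg.
apply: (le_trans (synth_le phiL c z HM)).
apply: (@le_trans _ _ (M * (N * (B * r)))).
  rewrite ler_pM2l// /cell_sum.
  apply: (@le_trans _ _ (\sum_(j : 'I_(L.+2.*2.+1) * 'rV['I_(L.+2.*2.+1)]_d) (B * r))).
    by apply: ler_sum => j _; exact: (Lpq_bound_coef p1 q1 _ _ bc).
  by rewrite sumr_const -mulr_natl.
by rewrite mulrDl mul1r !mulrA lerDl ltW.
Qed.

Lemma quasi_interpolant_contraction (eta : R) : 0 < eta ->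
  exists2 gamma : R, 0 < gamma &
  forall (J : countType) (x : J -> R) (y : J -> 'rV[R]_d) beta,
    strongly_separated x y -> bupu x y gamma beta ->
    forall h r, 0 < r -> Vpq p q phi h -> Lpq_bound h r ->
      Lpq_bound (fun z => h z - quasi_interpolant x y beta h z) (eta * r).
Proof.
move=> eta0; have [L phiL] := supp_bounded Kphi.
have [C C0 HC] := bounded_representation p1 q1 cphi Kphi mphi hP.
have [A A0 HA] := cell_sum_bound (d := d) p1 q1 L.
(* [C] bounds the coefficients of [h] and [A] their cell sums, so this oscillation of [phi] yields
   an error of exactly [eta * r]. *)
have e0 : 0 < eta / (A * C) by rewrite divr_gt0 ?mulr_gt0.
have [gamma /andP[g0 g1] osc] := uniformly_continuous_supp cphi Kphi e0.
exists gamma => // J x y beta sep hbeta h r r0 Vh bh.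
have [c bc hE] := HC h r r0 Vh bh.
have := Lpq_boundZ q1 (eta / (A * C))%:C%C (HA _ _ bc).
rewrite normc_real gtr0_norm// (_ : _ * (A * (C * r)) = eta * r); last first.
  by field; rewrite !gt_eqF.
apply: (Lpq_bound_dom p1 q1).
  apply: cmeasurableB; first by case: bh.
  exact: cmeasurable_quasi_interpolant sep hbeta _.
move=> z; rewrite Normc.normcM !normc_real gtr0_norm// ger0_norm ?cell_sum_ge0//.
apply: (quasi_interpolant_error sep hbeta) => w w1 w2; rewrite hE.
apply: (synth_osc_le phiL).
- by apply: ltW; exact: lt_le_trans w1 g1.
- by move=> i; apply: ltW; exact: lt_le_trans (w2 i) g1.
move=> a1 a2; apply: osc => /= [|i]; first by rewrite opprB addrA subrK.
by rewrite !mxE opprB addrA subrK.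
Qed.

Lemma iteration_contraction : exists2 gamma : R, 0 < gamma &
  forall (J : countType) (x : J -> R) (y : J -> 'rV[R]_d) beta,
    strongly_separated x y -> bupu x y gamma beta ->
    (forall g, Vpq p q phi g -> Lpq p q (quasi_interpolant x y beta g)) /\
    forall h v r, 0 < r -> Vpq p q phi h -> Lpq_bound h r -> cmeasurable v ->
      cae_eq (fun z => h z - P (quasi_interpolant x y beta h) z) v ->
      Lpq_bound v (r / 2).
Proof.
have [B B1 HB] := projection_bound p1 hP.
have B0 : 0 < B by exact: lt_le_trans B1.
(* [B] is the cost of [P]; the factors 8 pay for splitting [P (h - Q h)], for replacing [P h] by
   [h], and for passing to the representative [v]. The 2 is what remains as the contraction. *)
have e0 : 0 < (8 * 8 * 8 * 2 * B)^-1 by rewrite invr_gt0 !mulr_gt0.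
have [gamma g0 Hg] := quasi_interpolant_contraction e0.
exists gamma => // J x y beta sep hbeta.
have LQ g : Vpq p q phi g -> Lpq p q (quasi_interpolant x y beta g).
  move=> Vg; have /(LpqP q p1)[r bg] := Vpq_Lpq p1 q1 cphi Kphi mphi Vg.
  (* [r] may be 0, whereas [Hg] needs a positive bound. *)
  have bg' : Lpq_bound g (r + 1) by apply: (Lpq_bound_le p1 _ bg); rewrite lerDl.
  have r0 : 0 < r + 1 by rewrite ltr_wpDl// (Lpq_bound_ge0 bg).
  have := Lpq_boundB p1 q1 bg' (Hg J x y beta sep hbeta g _ r0 Vg bg').
  under eq_fun do rewrite opprB addrC subrK.
  by move=> H; apply/(LpqP q p1); eexists; exact: H.
split => // h v r r0 Vh bh mv hv.
have Lh := Vpq_Lpq p1 q1 cphi Kphi mphi Vh.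
have b1 := projectionB_bound p1 q1 hP Lh (LQ h Vh)
  (HB _ _ (Hg J x y beta sep hbeta h r r0 Vh bh)).
have b2 := Lpq_boundB p1 q1 b1 (projection_fix p1 q1 cphi Kphi mphi hP Vh).
move: b2; rewrite (_ : (fun z => _) = fun z => h z - P (quasi_interpolant x y beta h) z).
  move=> b2; have := Lpq_bound_ae p1 q1 mv hv b2.
  apply: (Lpq_bound_le p1); rewrite le_eqVlt; apply/orP; left; apply/eqP.
  by field; rewrite gt_eqF.
by apply/funext => z; rewrite opprB addrC subrKA.
Qed.

Lemma iterates_exist (Q : (pt -> R[i]) -> pt -> R[i]) f :
  (forall g, Vpq p q phi g -> Lpq p q (Q g)) -> Vpq p q phi f ->
  exists u, iterates p q phi P Q f u.
Proof.
move=> LQ Vf; have [_ _ _ _ [into _]] := hP.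
have H g : exists h, Vpq p q phi g -> Vpq p q phi h /\ cae_eq (P (Q g)) h.
  have [Vg|nVg] := pselect (Vpq p q phi g); last by exists 0.
  by have [h Vh Ph] := into _ (LQ g Vg); exists h.
have [F HF] := choice H.
(* [F] selects representatives in V. Starting from 0 makes the first iterate an instance of the
   general recurrence. *)
pose u := fix u n : pt -> R[i] :=
  if n is m.+1 then fun z => F (fun w => f w - u m w) z + u m z else fun=> 0.
have ae_sym (g h : pt -> R[i]) : cae_eq g h -> cae_eq h g.
  move=> gh; apply: lebesgue_prod_aeS gh.
  by move=> z /= ->.
have Vu n : Vpq p q phi (u n).
  elim: n => [|n IH]; first exact: (Vpq0 p1 q1 Kphi).
  apply: (VpqD p1 q1 Kphi) => //; have [] // := HF (fun w => f w - u n w).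
  exact: (VpqB p1 q1 Kphi).
have step n : cae_eq (u n.+1) (fun z => P (Q (fun w => f w - u n w)) z + u n z).
  have [|_ /ae_sym ae] := HF (fun w => f w - u n w); first exact: (VpqB p1 q1 Kphi).
  apply: lebesgue_prod_aeS ae.
  by move=> z /= ->.
exists u; split => //; have := step 0%N.
rewrite (_ : (fun w => f w - u 0%N w) = f); last by apply/funext => w; rewrite /= subr0.
by under [X in cae_eq _ X]eq_fun do rewrite /= addr0.
Qed.

Lemma cvg_uniform_normc (u : nat -> pt -> R[i]) (f : pt -> R[i]) :
  (forall e : R, 0 < e -> \forall n \near \oo, forall z, normc (f z - u n z) < e) ->
  {uniform, (u : nat -> pt -> R[i]^o) @ \oo --> (f : pt -> R[i]^o)}.
Proof.
move=> H A /uniform_nbhs[E [entE EA]].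
(* Balls of [R[i]^o] have complex radii; positivity forces the imaginary part [e'] to be 0. *)
move: entE; rewrite -entourage_ballE => -[[e e'] /= e0 eE].
move: e0; rewrite ltcE /= => /andP[/eqP e'0 e0].
apply: filterS (H e e0) => n Hn; apply: EA => z _; apply: eE => /=.
rewrite -ball_normE /= normc_def ltcE /= e'0 eqxx /=.
by have := Hn z; case: (f z - u n z).
Qed.

End reconstruction.

Unset Implicit Arguments.

Theorem theorem3p3 (R : realType) (d : nat) (p q : R)
    (phi : R * 'rV[R]_d -> R[i])
    (P : (R * 'rV[R]_d -> R[i]) -> R * 'rV[R]_d -> R[i])
    (hd : (1 <= d)%N) (hp : 1 <= p) (hq : 1 <= q)
    (hphi : W11_0 phi) (hsupp : compact (supp phi))
    (hfourier : forall xi : R * 'rV[R]_d,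
      (0 < \esum_(k in [set: int * 'rV[int]_d])
             (Normc.normc (fourier phi (shift2pi xi k)) ^+ 2)%:E)%E)
    (hP : bounded_projection p q phi P) :
  exists2 gamma : R, 0 < gamma &
  exists2 alpha : R, 0 <= alpha < 1 &
  forall (J : countType) (x : J -> R) (y : J -> 'rV[R]_d),
    strongly_separated x y -> dense_sampling x y gamma ->
  forall beta : J -> J -> R * 'rV[R]_d -> R, bupu x y gamma beta ->
    (forall g, Vpq p q phi g -> Lpq p q (quasi_interpolant x y beta g)) /\
    forall f, Vpq p q phi f ->
      (exists u, iterates p q phi P (quasi_interpolant x y beta) f u) /\
      forall u, iterates p q phi P (quasi_interpolant x y beta) f u ->
        [/\ Lpq_norm p q (fun z => f z - u n z)%R @[n --> \oo] --> 0%E,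
            {uniform, (u : nat -> R * 'rV[R]_d -> R[i]^o) @ \oo -->
                      (f : R * 'rV[R]_d -> R[i]^o)} &
            exists M : R, forall n, (1 <= n)%N ->
              (Lpq_norm p q (fun z => f z - u n z)%R <= (M * alpha ^+ n)%:E)%E].
Proof.
case: hphi => -[mphi _] cphi.
have [gamma g0 Hg] := iteration_contraction hp hq cphi hsupp mphi hP.
have [C C0 HC] := Vpq_sup_bound hp hq cphi hsupp mphi hP.
exists gamma => //; exists 2^-1; first by apply/andP; split; lra.
move=> J x y sep _ beta hbeta; have [LQ contr] := Hg J x y beta sep hbeta.
split=> // f Vf; split; first exact: (iterates_exist hp hq hsupp hP LQ Vf).
move=> u [Vu u1 uS].
have mV g : Vpq p q phi g -> cmeasurable g.
  by move=> Vg; have [] := Vpq_Lpq hp hq cphi hsupp mphi Vg.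
have mfu n : (1 <= n)%N -> cmeasurable (fun z => f z - u n z).
  by move=> n1; apply: cmeasurableB; apply: mV => //; exact: Vu.
have /(LpqP q hp)[s bs] := Vpq_Lpq hp hq cphi hsupp mphi Vf.
pose r := s + 1.
have r0 : 0 < r by rewrite ltr_wpDl// (Lpq_bound_ge0 bs).
have br : Lpq_bound p q f r by apply: (Lpq_bound_le hp _ bs); rewrite lerDl.
have geo n : 0 < r * 2^-1 ^+ n by rewrite mulr_gt0// exprn_gt0// invr_gt0.
have bn n : (1 <= n)%N -> Lpq_bound p q (fun z => f z - u n z) (r * 2^-1 ^+ n).
  elim: n => // n IH _; rewrite exprSr mulrA.
  (* [u 0] is unconstrained, so the induction starts at index 1, where the contraction is applied to
     [f] itself. *)
  case: n IH => [_|n IH].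
    rewrite expr0 mulr1; apply: (contr f _ r) => //; first exact: mfu.
    apply: lebesgue_prod_aeS u1.
    by move=> z /= ->.
  have Vh := VpqB hp hq hsupp Vf (Vu n.+1 isT).
  apply: (contr _ _ _ (geo n.+1) Vh (IH isT)); first exact: mfu.
  apply: lebesgue_prod_aeS (uS n.+1 isT).
  by move=> z /= ->; rewrite opprD addrA addrAC.
have norm_le n : (1 <= n)%N ->
    (Lpq_norm p q (fun z => f z - u n z)%R <= (r * 2^-1 ^+ n)%:E)%E.
  by move=> n1; apply: (Lpq_bound_norm hp); exact: bn.
have geo0 : (fun n => r * 2^-1 ^+ n) @ \oo --> (0 : R).
  by apply: cvg_geometric; rewrite gtr0_norm; lra.
split; last by exists r.
  apply: (@squeeze_cvge _ _ _ _ (cst 0%E) _ (EFin \o (fun n => r * 2^-1 ^+ n))).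
  - exists 1%N => // n /= n1; rewrite norm_le// andbT; exact: poweR_ge0.
  - exact: cvg_cst.
  - by apply/fine_cvgP; split => //; near=> n.
apply: cvg_uniform_normc => e e0.
have /cvgrPdist_lt /(_ (e / C)) := geo0; rewrite divr_gt0// => /(_ isT)[N _ HN].
(* The successor guarantees [n >= 1], where the estimates begin. *)
exists N.+1 => // n /= Nn z.
have n1 : (1 <= n)%N by exact: leq_ltn_trans Nn.
apply: le_lt_trans (HC _ _ (geo n) _ (bn n n1) z) _.
  exact: (VpqB hp hq hsupp Vf (Vu n n1)).
have := HN n (ltnW Nn); rewrite /= sub0r normrN gtr0_norm// ltr_pdivlMr// mulrC.
exact.
Unshelve. all: by end_near. Qed.
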